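(* Let $(M,\nabla)$ be an affine surface, let $\mu\in\mathbb{R}$ with $\mu\neq 0$, and let $\hat f\in C^\infty(M)$ satisfy $$\mathcal{H}_\nabla\hat f+2\rho_{s,\nabla}-\tfrac12\mu\, d\hat f\otimes d\hat f=0,$$ or, equivalently, let $f=e^{-\frac12\mu\hat f}$ satisfy $\mathcal{H}_\nabla f=\mu f\rho_{s,\nabla}$. Let $\pi:T^*M\to M$ be the natural projection, let $F=\pi^*\hat f$, and let $\Phi$ be an arbitrary symmetric $(0,2)$-tensor field on $M$. Then $(T^*M,g_{\nabla,\Phi},F,\mu_{T^*M})$ with $\mu_{T^*M}=\frac12\mu$ is a self-dual isotropic quasi-Einstein Walker manifold of signature $(2,2)$ with $\lambda=0$.
   Context: An affine surface $(M,\nabla)$ is a smooth $2$-dimensional manifold $M$ with a torsion free connection $\nabla$ on its tangent bundle; in local coordinates $\nabla_{\partial_{x^i}}\partial_{x^j}=\Gamma_{ij}{}^k\partial_{x^k}$ (Einstein summation). The Hessian is $\mathcal{H}_\nabla f=(\partial_{x^i}\partial_{x^j}f-\Gamma_{ij}{}^k\partial_{x^k}f)\,dx^i\otimes dx^j$. The curvature operator is $R_\nabla(x,y)=\nabla_x\nabla_y-\nabla_y\nabla_x-\nabla_{[x,y]}$, the Ricci tensor is $\rho_\nabla(x,y)=\operatorname{Tr}\{z\mapsto R_\nabla(z,x)y\}$, and $\rho_{s,\nabla}(x,y)=\frac12\{\rho_\nabla(x,y)+\rho_\nabla(y,x)\}$ is its symmetrization. If $(x^1,x^2)$ are local coordinates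 on $M$, let $(y_1,y_2)$ be the dual fiber coordinates on $T^*M$ (a 1-form is written $\omega=y_1dx^1+y_2dx^2$). The deformed Riemannian extension is the (invariantly defined) neutral signature metric on $T^*M$ $$g_{\nabla,\Phi}=2\,dx^i\circ dy_i+\{-2y_k\Gamma_{ij}{}^k+\Phi_{ij}\}\,dx^i\circ dx^j,$$ where $\circ$ is the symmetric product, $\alpha\circ\beta=\frac12(\alpha\otimes\beta+\beta\otimes\alpha)$. A quadruple $(N,g,F,\mu_N)$, with $(N,g)$ pseudo-Riemannian, $F\in C^\infty(N)$ and $\mu_N\in\mathbb{R}$, is a quasi-Einstein manifold if $\mathcal{H}_{\nabla^g}F+\rho_g-\mu_N\,dF\otimes dF=\lambda g$ for some $\lambda\in\mathbb{R}$, where $\nabla^g$ is the Levi-Civita connection and $\rho_g$ the Ricci tensor of $g$. It is isotropic if $\|dF\|_g^2=0$ identically. A $4$-dimensional manifold of signature $(2,2)$ is Walker if it admits a parallel totally null distribution of rank $2$; it is self-dual if the anti-self-dual part of its Weyl tensor vanishes (for the appropriate orientation). *)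

(* Defs.v *)
From mathcomp Require Import all_boot all_order all_algebra.
From mathcomp Require Import all_classical all_reals all_analysis.
From mathcomp Require Import ring.

Set Implicit Arguments.
Unset Strict Implicit.
Unset Printing Implicit Defensive.

Import Order.TTheory GRing.Theory Num.Theory.
Import numFieldNormedType.Exports.

Local Open Scope classical_set_scope.
Local Open Scope ring_scope.

(** * Calculus on open subsets of coordinate space *)

Section Calculus.
Context {R : realType} {n : nat}.

Definition partial (i : 'I_n) (f : 'rV[R]_n -> R) : 'rV[R]_n -> R :=
  fun x => 'D_(delta_mx 0 i) f x.

Fixpoint Ck (k : nat) (U : set 'rV[R]_n) (f : 'rV[R]_n -> R) : Prop :=
  match k with
  | 0%N => forall x, U x -> {for x, continuous f}
  | k'.+1 => forall i, (forall x, U x -> derivable f x (delta_mx 0 i)) /\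
                       Ck k' U (partial i f)
  end.

Definition smooth (U : set 'rV[R]_n) (f : 'rV[R]_n -> R) : Prop :=
  forall k, Ck k U f.

Definition smooth_mx (U : set 'rV[R]_n) p q (f : 'rV[R]_n -> 'M[R]_(p, q)) :
  Prop := forall i j, smooth U (fun x => f x i j).

Definition grad (f : 'rV[R]_n -> R) (x : 'rV[R]_n) : 'rV[R]_n :=
  \row_i partial i f x.

(** [G x i j k] is the Christoffel symbol of [nabla_{d_i} d_j] along [d_k]. *)
Definition christoffel_symbols := 'rV[R]_n -> 'I_n -> 'I_n -> 'I_n -> R.

Implicit Type G : christoffel_symbols.

Definition hessian G (f : 'rV[R]_n -> R) (x : 'rV[R]_n) : 'M[R]_n :=
  \matrix_(i, j) (partial i (partial j f) x -
                  \sum_k G x i j k * partial k f x).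

(** [R(d_i, d_j) d_k = \sum_l curvature G x i j k l *: d_l] *)
Definition curvature G x (i j k l : 'I_n) : R :=
  partial i (fun z => G z j k l) x - partial j (fun z => G z i k l) x
  + \sum_m (G x j k m * G x i m l - G x i k m * G x j m l).

(** [rho(d_j, d_k) = Tr (z |-> R(z, d_j) d_k)] *)
Definition ricci G x : 'M[R]_n :=
  \matrix_(j, k) \sum_i curvature G x i j k i.

Definition sym_ricci G x : 'M[R]_n := 2^-1 *: (ricci G x + (ricci G x)^T).

(** The components of [nabla_{d_i} Y]. *)
Definition covariant_derivative G (i : 'I_n) (Y : 'rV[R]_n -> 'rV[R]_n) x :
  'rV[R]_n :=
  \row_k (partial i (fun z => Y z 0 k) x + \sum_j G x i j k * Y x 0 j).

Implicit Type g : 'rV[R]_n -> 'M[R]_n.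

Definition levi_civita g : christoffel_symbols := fun x i j k =>
  2^-1 * \sum_l invmx (g x) k l *
    (partial i (fun z => g z j l) x + partial j (fun z => g z i l) x
     - partial l (fun z => g z i j) x).

(** [levi_civita g] is the torsion free solution of [nabla g = 0]. *)
Lemma levi_civitaP g G x :
    g x \in unitmx -> (forall y, (g y)^T = g y) ->
    (forall i j k, G x i j k = G x j i k) ->
  (forall k i j, partial k (fun z => g z i j) x =
     \sum_l (G x k i l * g x l j + G x k j l * g x i l)) <->
  (forall i j k, G x i j k = levi_civita g x i j k).
Proof.
move=> gU gT Gsym.
have gC y i j : g y i j = g y j i by rewrite -[in LHS]gT mxE.
pose d k i j := partial k (fun z => g z i j) x.
have dC k i j : d k i j = d k j i.
  by congr partial; apply/funext => z; exact: gC.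
pose L i j m := \sum_l G x i j l * g x l m.
have LC i j m : L i j m = L j i m by apply: eq_bigr => l _; rewrite Gsym.
have LE k i j :
    \sum_l (G x k i l * g x l j + G x k j l * g x i l) = L k i j + L k j i.
  by rewrite big_split; congr (_ + _); apply: eq_bigr => l _; rewrite gC.
have GL i j k : G x i j k = \sum_m L i j m * invmx (g x) m k.
  pose v : 'rV[R]_n := \row_l G x i j l.
  have : (v *m g x *m invmx (g x)) 0 k = v 0 k by rewrite mulmxK.
  rewrite !mxE => <-; apply: eq_bigr => m _; congr (_ * _).
  by rewrite mxE; apply: eq_bigr => l _; rewrite mxE.
have LG i j m : (forall k, G x i j k = levi_civita g x i j k) ->
    L i j m = 2^-1 * (d i j m + d j i m - d m i j).
  move=> GE; pose w : 'rV[R]_n := \row_l (d i j l + d j i l - d l i j).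
  have : (w *m invmx (g x) *m g x) 0 m = w 0 m by rewrite mulmxKV.
  rewrite [RHS]mxE mxE => <-; rewrite mulr_sumr; apply: eq_bigr => k _.
  rewrite GE mulrA; congr (_ * _ * _); rewrite mxE; apply: eq_bigr => l _.
  rewrite mxE mulrC; congr (_ * _).
  by rewrite -[in LHS](_ : (invmx (g x))^T = invmx (g x)) ?mxE// trmx_inv gT.
split=> [cpt i j k|GE k i j].
  rewrite GL /levi_civita mulr_sumr; apply: eq_bigr => l _.
  rewrite -/(d _ _ _) -/(d _ _ _) -/(d _ _ _) /d !cpt !LE.
  rewrite -[in RHS](_ : (invmx (g x))^T = invmx (g x)); last first.
    by rewrite trmx_inv gT.
  by rewrite mxE (LC j i) (LC l i) (LC l j); field.
rewrite LE !LG// -/(d k i j) (dC k j i) (dC j k i) (dC i k j).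
by field.
Qed.

(** [R_ijkl = g(R(d_i, d_j) d_k, d_l)] *)
Definition riemann g x (i j k l : 'I_n) : R :=
  \sum_m curvature (levi_civita g) x i j k m * g x m l.

Definition ricci_metric g x : 'M[R]_n := ricci (levi_civita g) x.

Definition scalar_curvature g x : R :=
  \sum_i \sum_j invmx (g x) i j * ricci_metric g x i j.

Definition weyl g x (i j k l : 'I_n) : R :=
  let rho := ricci_metric g x in
  riemann g x i j k l
  - (n%:R - 2)^-1 * (rho i l * g x j k - rho i k * g x j l
                     + rho j k * g x i l - rho j l * g x i k)
  + scalar_curvature g x / ((n%:R - 1) * (n%:R - 2))
    * (g x i l * g x j k - g x i k * g x j l).

End Calculus.

Arguments christoffel_symbols : clear implicits.

(** * Smooth manifolds, presented by an atlas *)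

(** The topology is the one for which the charts are homeomorphisms onto their
    images; [smooth_manifold] below states the axioms. *)
Record atlas (R : realType) (n : nat) := Atlas {
  point :> Type;
  chart : Type;
  dom : chart -> set point;
  crd : chart -> point -> 'rV[R]_n }.

Arguments dom {R n a} _ _.
Arguments crd {R n a} _ _.

Section Manifolds.
Context {R : realType} {n : nat} (M : atlas R n).
Implicit Types a b : chart M.

Definition chart_image a : set 'rV[R]_n := crd a @` dom a.

Definition overlap a b : set 'rV[R]_n := crd a @` (dom a `&` dom b).

(** [h \o (crd a)^-1]; only meaningful on [chart_image a]. *)
Definition in_chart (V : zmodType) a (h : M -> V) (x : 'rV[R]_n) : V :=
  xget 0 (h @` (dom a `&` crd a @^-1` [set x])).

Definition transition a b : 'rV[R]_n -> 'rV[R]_n := in_chart a (crd b).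

(** [jac a b x i j = d_i (x_b)^j] *)
Definition jac a b x : 'M[R]_n :=
  \matrix_(i, j) partial i (fun z => transition a b z 0 j) x.

Definition chart_open (W : set M) : Prop :=
  forall a, open (crd a @` (W `&` dom a)).

Definition smooth_atlas : Prop :=
  [/\ forall p : M, exists a, dom a p,
      forall a, {in dom a &, injective (crd a)},
      forall a b, open (overlap a b) &
      forall a b, smooth_mx (overlap a b) (transition a b)].

Definition hausdorff_atlas : Prop :=
  forall p q : M, p <> q -> exists U V : set M,
    [/\ chart_open U, chart_open V, U p, V q & U `&` V = set0].

Definition second_countable_atlas : Prop :=
  exists B : nat -> set M, (forall k, chart_open (B k)) /\
    forall (W : set M) (p : M), chart_open W -> W p ->
      exists k, B k p /\ B k `<=` W.

Definition smooth_manifold : Prop :=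
  [/\ smooth_atlas, hausdorff_atlas & second_countable_atlas].

Definition smooth_function (h : M -> R) : Prop :=
  forall a, smooth (chart_image a) (in_chart a h).

(** ** Connections and (0,2)-tensor fields, by their components in each chart *)

Definition connection_data := chart M -> christoffel_symbols R n.

Definition is_connection (G : connection_data) : Prop :=
  (forall a i j k, smooth (chart_image a) (fun x => G a x i j k)) /\
  (forall a b x, overlap a b x -> forall i j k,
     \sum_m G a x i j m * jac a b x m k =
     partial i (fun z => jac a b z j k) x +
     \sum_p \sum_q
       G b (transition a b x) p q k * jac a b x i p * jac a b x j q).

Definition torsion_free (G : connection_data) : Prop :=
  forall a x, chart_image a x -> forall i j k, G a x i j k = G a x j i k.

Definition tensor_data := chart M -> 'rV[R]_n -> 'M[R]_n.

Definition symmetric_tensor_field (T : tensor_data) : Prop :=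
  [/\ forall a, smooth_mx (chart_image a) (T a),
      forall a x, chart_image a x -> (T a x)^T = T a x &
      forall a b x, overlap a b x ->
        T a x = jac a b x *m T b (transition a b x) *m (jac a b x)^T].

Definition pseudo_riemannian (g : tensor_data) : Prop :=
  symmetric_tensor_field g /\ forall a x, chart_image a x -> g a x \in unitmx.

Definition has_signature (p q : nat) (g : tensor_data) : Prop :=
  (p + q = n)%N /\
  forall a x, chart_image a x -> exists2 P : 'M[R]_n, P \in unitmx &
    P *m g a x *m P^T = diag_mx (\row_(i < n) (if (i < p)%N then 1 else -1)).

(** [H f + rho_g - mu df (x) df = lambda g] *)
Definition quasi_einstein (g : tensor_data) (F : M -> R) (mu lambda : R) :
    Prop :=
  [/\ smooth_manifold, pseudo_riemannian g, smooth_function F &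
      forall a x, chart_image a x ->
        hessian (levi_civita (g a)) (in_chart a F) x + ricci_metric (g a) x
        - mu *: ((grad (in_chart a F) x)^T *m grad (in_chart a F) x)
        = lambda *: g a x].

Definition isotropic (g : tensor_data) (F : M -> R) : Prop :=
  forall a x, chart_image a x ->
    grad (in_chart a F) x *m invmx (g a x) *m (grad (in_chart a F) x)^T = 0.

(** ** Distributions: [D a x] has row space the subspace of the tangent space *)

Definition distribution_data := chart M -> 'rV[R]_n -> 'M[R]_n.

Definition is_distribution (r : nat) (D : distribution_data) : Prop :=
  [/\ forall a x, chart_image a x -> \rank (D a x) = r,
      forall a b x, overlap a b x ->
        (D a x *m jac a b x == D b (transition a b x))%MS &
      forall a x, chart_image a x ->
        exists (U : set 'rV[R]_n) (B : 'rV[R]_n -> 'M[R]_(r, n)),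
        [/\ open U, U x, U `<=` chart_image a, smooth_mx U B &
            forall z, U z -> (B z == D a z)%MS]].

Definition parallel (g : tensor_data) (D : distribution_data) : Prop :=
  forall a (U : set 'rV[R]_n) (Y : 'rV[R]_n -> 'rV[R]_n),
    open U -> U `<=` chart_image a -> smooth_mx U Y ->
    (forall z, U z -> (Y z <= D a z)%MS) ->
  forall z i, U z ->
    (covariant_derivative (levi_civita (g a)) i Y z <= D a z)%MS.

Definition totally_null (g : tensor_data) (D : distribution_data) : Prop :=
  forall a x, chart_image a x -> D a x *m g a x *m (D a x)^T = 0.

(** [o a x] is the sign of the coordinate frame of the chart [a]. *)
Definition is_orientation (o : chart M -> 'rV[R]_n -> R) : Prop :=
  [/\ forall a x, chart_image a x -> o a x = 1 \/ o a x = -1,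
      forall a x, chart_image a x -> {for x, continuous (o a)} &
      forall a b x, overlap a b x ->
        o a x = Num.sg (\det (jac a b x)) * o b (transition a b x)].

End Manifolds.

Section FourDim.
Context {R : realType} (N : atlas R 4).

Definition walker (g : tensor_data N) : Prop :=
  has_signature 2 2 g /\
  exists D, [/\ is_distribution 2 D, parallel g D & totally_null g D].

(** The Levi-Civita symbol, as the determinant of a matrix of unit vectors. *)
Definition epsilon (i j k l : 'I_4) : R :=
  \det (\matrix_(r < 4, c < 4) (tnth [tuple i; j; k; l] r == c)%:R).

Definition volume_form (g : 'M[R]_4) (s : R) (i j k l : 'I_4) : R :=
  s * Num.sqrt `|\det g| * epsilon i j k l.

(** [star], acting on 2-forms, is an involution in signature (2,2). *)
Definition hodge_star (g : 'M[R]_4) (s : R) (w : 'I_4 -> 'I_4 -> R)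
    (i j : 'I_4) : R :=
  2^-1 * \sum_p \sum_q \sum_r \sum_t
    volume_form g s i j p q * invmx g p r * invmx g q t * w r t.

Definition weyl_asd (g : 'rV[R]_4 -> 'M[R]_4) (s : R) x (i j k l : 'I_4) : R :=
  2^-1 * (weyl g x i j k l -
          hodge_star (g x) s (fun p q => weyl g x p q k l) i j).

Definition self_dual (g : tensor_data N) : Prop :=
  exists2 o, is_orientation o &
    forall a x, chart_image a x -> forall i j k l,
      weyl_asd (g a) (o a x) x i j k l = 0.

End FourDim.

(** * The cotangent bundle and the deformed Riemannian extension *)

Section Cotangent.
Context {R : realType} {n : nat} (M : atlas R n).

(** A covector is given by its components in all charts around its foot point
    (and by [0] elsewhere, so that equal covectors are equal records). *)
Record covector := Covector {
  foot : M;
  cov : chart M -> 'rV[R]_n;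
  cov_out : forall a, ~ dom a foot -> cov a = 0;
  cov_law : forall a b, dom a foot -> dom b foot ->
    cov a = cov b *m (jac a b (crd a foot))^T }.

Definition cotangent_bundle : atlas R (n + n) := @Atlas R (n + n)
  covector (chart M)
  (fun a w => dom a (foot w))
  (fun a w => row_mx (crd a (foot w)) (cov w a)).

(** In the coordinates (x, y): [g(dx_i, dx_j) = Phi_ij - 2 y_k G_ij^k],
    [g(dx_i, dy_j) = delta_ij] and [g(dy_i, dy_j) = 0]. *)
Definition riemannian_extension (G : connection_data M) (Phi : tensor_data M) :
    tensor_data cotangent_bundle :=
  fun a z => let x := lsubmx z in let y := rsubmx z in
    block_mx
      (\matrix_(i, j) (- 2 * \sum_k y 0 k * G a x i j k + Phi a x i j)) 1%:M
      1%:M 0.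

End Cotangent.

Definition affine_surface {R : realType} (M : atlas R 2)
    (nabla : connection_data M) : Prop :=
  [/\ smooth_manifold M, is_connection nabla & torsion_free nabla].

(* Main.v *)
(** In the coordinates [(x, y)] induced on the cotangent bundle, the metric is
    the block matrix [[S, 1], [1, 0]] with [S] affine in [y].  Its Levi-Civita
    symbols are therefore explicit, and the only complicated ones, [G_ij^k] with
    [i], [j] base indices and [k] a fibre index, enter the argument through
    their [y]-derivatives only.  The Ricci tensor turns out to be the pull-back
    of [2 rho_s], the scalar curvature vanishes, and the Hessian of the
    pull-back of [fhat] is the pull-back of its Hessian: the quasi-Einstein
    equation is the pull-back of the affine one.  The parallel null
    distribution consists of the tangent spaces of the fibres.

    On a surface the curvature is determined by the Ricci tensor; this makes the
    Weyl components [W(d_x^a, d_y_b, ., .)] multiples of [delta_ab], while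
    [W(d_y_a, d_y_b, ., .) = 0], and 2-forms of this shape are self-dual.  The
    orientation is the one of the induced charts, whose transition functions
    have Jacobian determinant 1.

    The transformation law of the metric is obtained by differentiating the
    identity [y' J^T = y] between fibre coordinates along the base. *)

From HB Require Import structures.
Require Import Defs.
From mathcomp Require Import all_boot all_order all_algebra.
From mathcomp Require Import all_classical all_reals all_analysis.
From mathcomp Require Import perm ring.

Set Implicit Arguments.
Unset Strict Implicit.
Unset Printing Implicit Defensive.

Import Order.TTheory GRing.Theory Num.Theory.
Import numFieldNormedType.Exports.

Local Open Scope classical_set_scope.
Local Open Scope ring_scope.

(** * Differential calculus in coordinates *)

(** Differentiability is stated through the chosen differential of [f]; [diff_unique] identifies
    that choice with [df], so an explicit bound on the remainder suffices. *)
Lemma differentiable_approx {R : realType} {V W : normedModType R} (f : V -> W)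
    (df : {linear V -> W}) (x : V) :
  continuous df ->
  (forall e : R, 0 < e -> \forall h \near (0 : V),
     `|f (x + h) - f x - df h| <= e * `|h|) ->
  differentiable f x.
Proof.
move=> dfc H.
have E : f \o shift x = cst (f x) + df +o_ (0 : V) id.
  apply/eqaddoP => e e0; near=> h.
  rewrite fctE /= opprD addrA [h + x]addrC.
  by near: h; exact: H.
have D := diff_unique dfc E.
by apply/diff_locallyP; rewrite D.
Unshelve. all: by end_near. Qed.

Section PartialDerivatives.
Context {R : realType} {n : nat}.
Implicit Types (f g : 'rV[R]_n -> R) (x : 'rV[R]_n) (U : set 'rV[R]_n).

Lemma is_derive_line f x i (t : R) :
  derivable f (x + t *: delta_mx 0 i) (delta_mx 0 i) ->
  is_derive t 1 (fun s : R => f (x + s *: delta_mx 0 i))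
    (partial i f (x + t *: delta_mx 0 i)).
Proof.
rewrite /partial /derivable /derive => fd.
have E : (fun h : R => h^-1 *: (((fun s : R => f (x + s *: delta_mx 0 i)) \o
      shift t) (h *: 1) - f (x + t *: delta_mx 0 i))) =
    (fun h => h^-1 *: ((f \o shift (x + t *: delta_mx 0 i))
      (h *: delta_mx 0 i) - f (x + t *: delta_mx 0 i))).
  apply/funext => h /=; congr (_ *: (f _ - _)).
  by rewrite scalerDl addrCA [_%:A]mulr1.
by apply: DeriveDef; rewrite /derivable /derive E.
Qed.

Lemma MVT_line f x i (t : R) :
  (forall s : R, `|s| <= `|t| ->
     derivable f (x + s *: delta_mx 0 i) (delta_mx 0 i)) ->
  exists2 s : R, `|s| <= `|t| &
    f (x + t *: delta_mx 0 i) - f x = partial i f (x + s *: delta_mx 0 i) * t.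
Proof.
move=> fd; pose F (s : R) : R := f (x + s *: delta_mx 0 i).
pose dF (s : R) : R := partial i f (x + s *: delta_mx 0 i).
have FD (s : R) : `|s| <= `|t| -> is_derive s 1 F (dF s).
  by move=> /fd; exact: is_derive_line.
have F0 : F 0 = f x by rewrite /F scale0r addr0.
have Fc (a b : R) : (forall s, s \in `[a, b]%R -> `|s| <= `|t|) ->
    {within `[a, b], continuous F}.
  move=> ab; apply: derivable_within_continuous => s /ab/FD.
  by move=> H; exact: ex_derive.
(* [MVT_segment] needs ordered endpoints; for negative [t] it is applied on [[t, 0]], and the two
   changes of sign cancel. *)
rewrite -F0 -/(F t) -/(dF _); have [t0|t0] := leP 0 t.
  have st s : s \in `[0, t]%R -> `|s| <= `|t|.
    by rewrite in_itv/= => /andP[s0 st]; rewrite !ger0_norm.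
  have [s sI Es] := @MVT_segment _ F dF 0 t t0
    (fun s sI => FD s (st s (subset_itv_oo_cc sI))) (Fc _ _ st).
  by exists s; rewrite ?Es ?subr0//; exact: st.
have st s : s \in `[t, 0]%R -> `|s| <= `|t|.
  by rewrite in_itv/= => /andP[s0 s1]; rewrite !ler0_norm ?lerN2// ltW.
have [s sI Es] := @MVT_segment _ F dF t 0 (ltW t0)
  (fun s sI => FD s (st s (subset_itv_oo_cc sI))) (Fc _ _ st).
exists s; [exact: st|].
by rewrite -opprB Es sub0r mulrN opprK.
Qed.

Lemma norm_row_coord (h : 'rV[R]_n) j : `|h 0 j| <= `|h|.
Proof.
by rewrite [leRHS]/Num.Def.normr/= mx_normrE; exact: (le_bigmax _ _ (0, j)).
Qed.

Lemma row_norm_le (h : 'rV[R]_n) (c : R) :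
  0 <= c -> (forall j, `|h 0 j| <= c) -> `|h| <= c.
Proof.
move=> c0 H; rewrite [leLHS]/Num.Def.normr/= mx_normrE bigmax_le// => -[i j] _.
by rewrite /= ord1.
Qed.

(* The increment is split into [n] steps parallel to the axes, to each of which
   the mean value theorem applies. *)
Lemma C1_differentiable f x :
  (\forall y \near x, forall i, derivable f y (delta_mx 0 i)) ->
  (forall i, {for x, continuous (partial i f)}) ->
  differentiable f x.
Proof.
move=> fd fc; pose d (h : 'rV[R]_n) := \sum_i h 0 i * partial i f x.
have dL : linear d.
  move=> a u v; rewrite /d -[X in _ = X + _]/(a * _) mulr_sumr -big_split/=;
    apply: eq_bigr => i _.
  by rewrite !mxE mulrDl mulrA.
pose dl : {linear 'rV[R]_n -> R} :=
  HB.pack d (GRing.isLinear.Build _ _ _ _ _ dL).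
apply: (@differentiable_approx _ _ _ f dl).
  have E : (dl : 'rV[R]_n -> R) =
      \sum_i (fun h : 'rV[R]_n => h 0 i * partial i f x).
    by apply/funext => u; rewrite fct_sumE.
  move=> h; apply: differentiable_continuous; rewrite E.
  apply: differentiable_sum => i; apply: differentiableM => //.
  exact: differentiable_coord.
move=> e e0.
(* The divisor [n.+1] is positive even in dimension zero; the [n] errors then add up to at most
   [e * n / n.+1], hence at most [e], times the norm of [h]. *)
have ne0 : 0 < e / n.+1%:R by rewrite divr_gt0// ltr0n.
have : \forall y \near x, forall i, derivable f y (delta_mx 0 i) /\
    `|partial i f x - partial i f y| <= e / n.+1%:R.
  near=> y => i; split; first by move: i; near: y; exact: fd.
  move: i; near: y; apply: filter_forall => i.
  by move/cvgrPdist_le: (fc i) => /(_ _ ne0).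
move=> /nbhs_ballP[r /= r0 rP].
have near_h : \forall h \near (0 : 'rV[R]_n), `|h| < r.
  by apply/nbhs_ballP; exists r => //= h; rewrite -ball_normE /ball_/= sub0r
    normrN.
apply: filterS near_h => h hr.
pose p (k : nat) : 'rV[R]_n := \row_j (if (j < k)%N then h 0 j else 0).
have pS (k : 'I_n) : p k.+1 = p k + h 0 k *: delta_mx 0 k.
  apply/rowP => j; rewrite !mxE eqxx /= ltnS leq_eqVlt.
  have [->|jk] := eqVneq j k; first by rewrite eqxx ltnn mulr1 add0r.
  by rewrite (negbTE jk : _ == _ :> nat = false) mulr0 addr0.
(* The whole path stays in the ball: in the maximum norm, its displacement from [x] is bounded
   coordinatewise by [h]. *)
have near_p (k : 'I_n) (s : R) : `|s| <= `|h 0 k| ->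
    ball x r (x + p k + s *: delta_mx 0 k).
  move=> sk; rewrite -ball_normE /ball_/= opprD opprD !addrA subrr sub0r.
  rewrite -opprD normrN (le_lt_trans _ hr)//; apply: row_norm_le => // j.
  rewrite !mxE eqxx/=; have [->|jk] := eqVneq j k.
    by rewrite ltnn mulr1 add0r (le_trans sk)// norm_row_coord.
  by rewrite mulr0 addr0; case: ifP => _; rewrite ?normr0 // norm_row_coord.
have pn : p n = h by apply/rowP => j; rewrite !mxE ltn_ord.
have p0 : p 0%N = 0 by apply/rowP => j; rewrite !mxE.
have -> : f (x + h) - f x - dl h =
    \sum_(k < n) (f (x + p k.+1) - f (x + p k) - h 0 k * partial k f x).
  rewrite sumrB -(big_mkord xpredT (fun k => f (x + p k.+1) - f (x + p k))).
  by rewrite telescope_sumr// pn p0 addr0.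
rewrite (le_trans (ler_norm_sum _ _ _))//.
apply: (@le_trans _ _ (\sum_(k < n) e / n.+1%:R * `|h|)).
  apply: ler_sum => k _; rewrite pS addrA.
  have [s sk ->] := @MVT_line f (x + p k) k (h 0 k)
    (fun s sk => (rP _ (near_p _ _ sk) k).1).
  rewrite (mulrC (partial _ _ _)) -mulrBr normrM mulrC ler_pM//
    ?norm_row_coord//.
  by rewrite distrC; have [] := rP _ (near_p _ _ sk) k.
rewrite sumr_const card_ord -[X in X <= _]mulr_natl mulrA ler_wpM2r//.
by rewrite mulrA ler_pdivrMr ?ltr0n// mulrC ler_pM2l// ler_nat.
Unshelve. all: by end_near. Qed.

End PartialDerivatives.

(** * Closure properties of the classes [Ck] and of smooth functions *)

Section SmoothFunctions.
Context {R : realType} {n : nat}.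
Implicit Types (f g : 'rV[R]_n -> R) (x : 'rV[R]_n) (U V : set 'rV[R]_n).

Lemma open_near_eq {T : Type} U (f g : 'rV[R]_n -> T) x :
  open U -> U x -> (forall y, U y -> f y = g y) -> \near x, f x = g x.
Proof.
by move=> oU Ux fg; apply: filterS (open_nbhs_nbhs (conj oU Ux)) => y /fg.
Qed.

Lemma partial_ext U f g i x : open U -> U x -> (forall y, U y -> f y = g y) ->
  partial i f x = partial i g x.
Proof. by move=> oU Ux fg; exact/near_eq_derive/(open_near_eq oU Ux fg). Qed.

Lemma derivable_ext U f g x v : open U -> U x -> (forall y, U y -> f y = g y) ->
  derivable f x v -> derivable g x v.
Proof. by move=> oU Ux fg; exact/near_eq_derivable/(open_near_eq oU Ux fg). Qed.

Lemma Ck_ext k U f g : open U -> (forall y, U y -> f y = g y) ->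
  Ck k U f -> Ck k U g.
Proof.
move=> oU; elim: k f g => [|k IHk] f g fg /=.
  move=> H x Ux; move: (H x Ux); rewrite /prop_for /continuous_at -(fg x Ux).
  move=> fc; apply: cvg_trans fc; exact: (near_eq_cvg (open_near_eq oU Ux fg)).
move=> H i; have [fd fC] := H i; split.
  by move=> x Ux; exact: derivable_ext oU Ux fg (fd x Ux).
by apply: IHk fC => y Uy; exact: partial_ext oU Uy fg.
Qed.

Lemma Ck1_differentiable U f x : open U -> U x -> Ck 1 U f ->
  differentiable f x.
Proof.
move=> oU Ux H; apply: C1_differentiable.
  apply: filterS (open_nbhs_nbhs (conj oU Ux)) => y Uy i.
  by have [] := H i => /(_ y Uy).
by move=> i; have [_] := H i => /(_ x Ux).
Qed.

(** Not immediate from the recursion, which never mentions continuity of [f] itself at positive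
    order: that comes from the continuous partial derivatives, through [C1_differentiable]. *)
Lemma CkS k U f : open U -> Ck k.+1 U f -> Ck k U f.
Proof.
move=> oU; elim: k f => [|k IHk] f H.
  by move=> x Ux; apply: differentiable_continuous;
    exact: Ck1_differentiable oU Ux H.
by move=> i; have [fd fC] := H i; split => //; exact: IHk.
Qed.

Lemma Ck_cst k U (c : R) : Ck k U (fun=> c).
Proof.
elim: k c => [|k IHk] c /=; first by move=> x _; apply: cst_continuous.
move=> i; split => [x _|]; first exact: (@derivable_cst _ _ _ c).
by rewrite (_ : partial i _ = fun=> 0)//; apply/funext => x;
  exact: (derive_cst c).
Qed.

Lemma CkD k U f g : open U -> Ck k U f -> Ck k U g ->
  Ck k U (fun x => f x + g x).
Proof.
move=> oU; elim: k f g => [|k IHk] f g F G /=.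
  by move=> x Ux; apply: continuousD; [exact: F|exact: G].
move=> i; have [fd fC] := F i; have [gd gC] := G i; split => [x Ux|].
  by apply: derivableD; [exact: fd|exact: gd].
apply: Ck_ext (IHk _ _ fC gC) => // y Uy.
by rewrite /partial [RHS]deriveD//; [exact: fd|exact: gd].
Qed.

Lemma CkM k U f g : open U -> Ck k U f -> Ck k U g ->
  Ck k U (fun x => f x * g x).
Proof.
move=> oU; elim: k f g => [|k IHk] f g F G.
  by move=> x Ux; apply: continuousM; [exact: F|exact: G].
move=> i; have [fd fC] := F i; have [gd gC] := G i; split => [x Ux|].
  by apply: derivableM; [exact: fd|exact: gd].
(* Each term of the product rule keeps one factor undifferentiated; [CkS] lowers its order to match
   the induction hypothesis. *)
have H := CkD oU (IHk _ _ (CkS oU F) gC) (IHk _ _ (CkS oU G) fC).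
apply: Ck_ext H => // y Uy.
by rewrite /partial [RHS]deriveM//; [exact: fd|exact: gd].
Qed.

Lemma Ck_sum k U m (f : 'I_m -> 'rV[R]_n -> R) : open U ->
  (forall j, Ck k U (f j)) -> Ck k U (fun x => \sum_j f j x).
Proof.
move=> oU; elim: m f => [|m IHm] f H.
  apply: (Ck_ext oU _ (Ck_cst k U 0)) => y _; by rewrite big_ord0.
apply: (Ck_ext oU _ (CkD oU (H ord0) (IHm _ (fun j => H (lift ord0 j))))) =>
  y _.
by rewrite big_ord_recl.
Qed.

Lemma smooth_ext U f g : open U -> (forall y, U y -> f y = g y) ->
  smooth U f -> smooth U g.
Proof. by move=> oU fg F k; exact: Ck_ext (F k). Qed.

Lemma smooth_cst U (c : R) : smooth U (fun=> c).
Proof. by move=> k; exact: Ck_cst. Qed.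

Lemma smoothD U f g : open U -> smooth U f -> smooth U g ->
  smooth U (fun x => f x + g x).
Proof. by move=> oU F G k; exact: CkD. Qed.

Lemma smoothM U f g : open U -> smooth U f -> smooth U g ->
  smooth U (fun x => f x * g x).
Proof. by move=> oU F G k; exact: CkM. Qed.

Lemma smooth_sum U m (f : 'I_m -> 'rV[R]_n -> R) : open U ->
  (forall j, smooth U (f j)) -> smooth U (fun x => \sum_j f j x).
Proof. by move=> oU F k; apply: Ck_sum => // j; exact: F. Qed.

Lemma smooth_partial U f i : smooth U f -> smooth U (partial i f).
Proof. by move=> F k; have [] := F k.+1 i. Qed.

Lemma smooth_derivable U f x i : U x -> smooth U f ->
  derivable f x (delta_mx 0 i).
Proof. by move=> Ux F; have [] := F 1%N i => /(_ x Ux). Qed.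

Lemma smooth_continuous U f x : U x -> smooth U f -> {for x, continuous f}.
Proof. by move=> Ux F; exact: (F 0%N). Qed.

Lemma smooth_differentiable U f x : open U -> U x -> smooth U f ->
  differentiable f x.
Proof. by move=> oU Ux F; exact: Ck1_differentiable oU Ux (F 1%N). Qed.

Lemma partial_coord i j x : partial i (fun z => z 0 j) x = (i == j)%:R.
Proof.
rewrite /partial deriveE; last exact: differentiable_coord.
rewrite (_ : 'd _ x = (fun z : 'rV[R]_n => z 0 j) :> (_ -> _)) ?mxE ?eqxx
  1?eq_sym//.
have cL : linear (fun z : 'rV[R]_n => z 0 j) by move=> a u v; rewrite !mxE.
pose c : {linear 'rV[R]_n -> R} := HB.pack (fun z : 'rV[R]_n => z 0 j)
  (GRing.isLinear.Build _ _ _ _ _ cL).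
by rewrite -[fun z => _]/(c : _ -> _) diff_lin//; exact: coord_continuous.
Qed.

Lemma smooth_coord U j : smooth U (fun z => z 0 j).
Proof.
case=> [x _|k i]; first exact: coord_continuous.
split=> [x _|]; first exact/diff_derivable/differentiable_coord.
rewrite (_ : partial i _ = fun=> (i == j)%:R); first exact: Ck_cst.
by apply/funext => x; rewrite partial_coord.
Qed.

End SmoothFunctions.

(** * The chain rule and smoothness of composites *)

Section ChainRule.
Context {R : realType} {m n : nat}.
Variables (phi : 'rV[R]_n -> 'rV[R]_m).

Lemma differentiable_row x :
  (forall j, differentiable (fun z => phi z 0 j) x) -> differentiable phi x.
Proof.
move=> phid.
have -> : phi = \sum_j (fun z => phi z 0 j *: delta_mx 0 j).
  by apply/funext => z; rewrite fct_sumE {1}(row_sum_delta (phi z)).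
by apply: differentiable_sum => j; exact: differentiableZl.
Qed.

Lemma chain_rule (f : 'rV[R]_m -> R) x i :
  (forall j, differentiable (fun z => phi z 0 j) x) ->
  differentiable f (phi x) ->
  derivable (f \o phi) x (delta_mx 0 i) /\
  partial i (f \o phi) x =
    \sum_j partial i (fun z => phi z 0 j) x * partial j f (phi x).
Proof.
move=> /differentiable_row phid fd.
have fphid : differentiable (f \o phi) x by exact: differentiable_comp.
split; first exact: diff_derivable.
rewrite /partial deriveE// diff_comp//= -(deriveE _ phid).
rewrite derive_mx; last exact: diff_derivable.
rewrite [X in 'd f _ X]row_sum_delta linear_sum; apply: eq_bigr => j _.
by rewrite linearZ/= mxE (deriveE _ fd).
Qed.

(** Induction on the order with [f] generalized: by the chain rule a partial derivative of the
    composite is a sum of derivatives of [phi] times composites of partial derivatives of [f], which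
    are again smooth. *)
Lemma smooth_comp (U : set 'rV[R]_n) (V : set 'rV[R]_m) (f : 'rV[R]_m -> R) :
  open U -> open V -> (forall x, U x -> V (phi x)) ->
  smooth_mx U phi -> smooth V f -> smooth U (fun x => f (phi x)).
Proof.
move=> oU oV UV sphi sf k.
have phid x j : U x -> differentiable (fun z => phi z 0 j) x.
  by move=> Ux; exact: smooth_differentiable oU Ux (sphi 0 j).
elim: k f sf => [|k IHk] f sf.
  move=> x Ux; apply: (@continuous_comp _ _ _ phi f).
    by apply: differentiable_continuous; apply: differentiable_row => j;
      exact: phid.
  exact: smooth_continuous (UV x Ux) sf.
have fd x : U x -> differentiable f (phi x).
  by move=> Ux; exact: smooth_differentiable oV (UV x Ux) sf.
move=> i; split=> [x Ux|].
  by have [] := chain_rule i (fun j => phid x j Ux) (fd x Ux).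
have H : Ck k U (fun x =>
    \sum_j partial i (fun z => phi z 0 j) x * partial j f (phi x)).
  apply: Ck_sum => // j; apply: CkM => //.
    by have [] := sphi 0 j k.+1 i.
  by apply: IHk; exact: smooth_partial.
apply: (Ck_ext oU _ H) => x Ux.
by have [] := chain_rule i (fun j => phid x j Ux) (fd x Ux).
Qed.

End ChainRule.

(** A directional derivative sees only the values along one line, so the two ambient spaces may
    differ. This reduces derivatives on the total space to derivatives along the base or the
    fibre. *)
Lemma derive_eq_along {R : numFieldType} {V V' W : normedModType R}
    (f : V -> W) (g : V' -> W) a v a' v' :
  (forall h : R, f (h *: v + a) = g (h *: v' + a')) ->
  'D_v f a = 'D_v' g a'.
Proof.
move=> fg; have fga : f a = g a' by have := fg 0; rewrite !scale0r !add0r.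
rewrite /derive (_ : (fun h => _) =
  (fun h => h^-1 *: ((g \o shift a') (h *: v') - g a')))//.
by apply/funext => h /=; rewrite fg fga.
Qed.

Section PartialRules.
Context {R : realType} {n : nat}.
Implicit Types (f g : 'rV[R]_n -> R) (x : 'rV[R]_n).

Lemma partial_cst i (c : R) (x : 'rV[R]_n) : partial i (fun=> c) x = 0.
Proof. exact: (@derive_cst _ _ _ c). Qed.

Lemma partialD i f g x :
  derivable f x (delta_mx 0 i) -> derivable g x (delta_mx 0 i) ->
  partial i (fun x => f x + g x) x = partial i f x + partial i g x.
Proof. exact: deriveD. Qed.

Lemma partialN i f x :
  derivable f x (delta_mx 0 i) ->
  partial i (fun x => - f x) x = - partial i f x.
Proof. exact: deriveN. Qed.

Lemma partialM i f g x :
  derivable f x (delta_mx 0 i) -> derivable g x (delta_mx 0 i) ->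
  partial i (fun x => f x * g x) x = f x * partial i g x + partial i f x * g x.
Proof.
move=> df dg.
have -> : partial i (fun x => f x * g x) x = 'D_(delta_mx 0 i) (f * g) x by [].
by rewrite (deriveM df dg) -[X in _ + X]/(g x * partial i f x) (mulrC (g x)).
Qed.

Lemma partialZ i (c : R) f x :
  derivable f x (delta_mx 0 i) ->
  partial i (fun x => c * f x) x = c * partial i f x.
Proof. by move=> df; exact: (deriveZ c df). Qed.

Lemma derivable_sum_row m (f : 'I_m -> 'rV[R]_n -> R) x v :
  (forall r, derivable (f r) x v) -> derivable (fun x => \sum_r f r x) x v.
Proof.
by move=> df; rewrite -(_ : \sum_r f r = fun x => \sum_r f r x);
  [exact: derivable_sum|apply/funext => y; rewrite fct_sumE].
Qed.

Lemma partial_sum i m (f : 'I_m -> 'rV[R]_n -> R) x :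
  (forall r, derivable (f r) x (delta_mx 0 i)) ->
  partial i (fun x => \sum_r f r x) x = \sum_r partial i (f r) x.
Proof.
move=> df; rewrite /partial -derive_sum//; congr (derive _ _ _).
by apply/funext => y; rewrite fct_sumE.
Qed.

End PartialRules.

(** * Partial derivatives in base and fibre coordinates *)

Section SplitCoordinates.
Context {R : realType} {n : nat}.
Implicit Types (F : 'rV[R]_(n + n) -> R) (z : 'rV[R]_(n + n)).

Lemma partial_lshift F z i : partial (lshift n i) F z =
  partial i (fun x => F (row_mx x (rsubmx z))) (lsubmx z).
Proof.
apply: derive_eq_along => h; congr F.
rewrite -[LHS]hsubmxK !linearD/= !linearZ/=; congr row_mx.
  by apply/rowP => j; rewrite !mxE /= (inj_eq (@lshift_inj _ _)).
by apply/rowP => j; rewrite !mxE /= eq_rlshift mulr0 add0r.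
Qed.

Lemma partial_rshift F z i : partial (rshift n i) F z =
  partial i (fun y => F (row_mx (lsubmx z) y)) (rsubmx z).
Proof.
apply: derive_eq_along => h; congr F.
rewrite -[LHS]hsubmxK !linearD/= !linearZ/=; congr row_mx.
  by apply/rowP => j; rewrite !mxE /= eq_lrshift mulr0 add0r.
by apply/rowP => j; rewrite !mxE /= (inj_eq (@rshift_inj _ _)).
Qed.

Lemma partial_r_base (F : 'rV[R]_(n + n) -> R) (h : 'rV[R]_n -> R) z k :
  (forall y, F y = h (lsubmx y)) -> partial (rshift n k) F z = 0.
Proof.
move=> Fh; rewrite partial_rshift.
by under [X in partial _ X]eq_fun do rewrite Fh row_mxKl; exact: partial_cst.
Qed.

Lemma partial_l_base (F : 'rV[R]_(n + n) -> R) (h : 'rV[R]_n -> R) z k :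
  (forall y, F y = h (lsubmx y)) ->
  partial (lshift n k) F z = partial k h (lsubmx z).
Proof.
move=> Fh; rewrite partial_lshift.
by under [X in partial _ X]eq_fun do rewrite Fh row_mxKl.
Qed.

Lemma partial_eq0 (F : 'rV[R]_(n + n) -> R) z (k : 'I_(n + n)) :
  (forall y, F y = 0) -> partial k F z = 0.
Proof. by move=> F0; rewrite (funext F0); exact: partial_cst. Qed.

(** The common shape of the metric block, of the complicated Christoffel symbols and of the fibre
    transition functions: all are affine in the fibre coordinates. *)
Lemma partial_r_affine (a : R) (h : 'I_n -> 'rV[R]_n -> R)
    (h0 : 'rV[R]_n -> R) z k :
  partial (rshift n k) (fun z =>
    a * (\sum_r rsubmx z 0 r * h r (lsubmx z)) + h0 (lsubmx z)) z =
  a * h k (lsubmx z).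
Proof.
rewrite partial_rshift.
under [X in partial _ X]eq_fun do rewrite row_mxKl row_mxKr.
have dc r : derivable (fun y : 'rV[R]_n => y 0 r) (rsubmx z) (delta_mx 0 k).
  exact/diff_derivable/differentiable_coord.
have d r : derivable (fun y : 'rV[R]_n => y 0 r * h r (lsubmx z)) (rsubmx z)
    (delta_mx 0 k).
  by apply: derivableM => //; exact: (@derivable_cst _ _ _ (h r (lsubmx z))).
rewrite partialD; last 2 first.
- by apply: derivableZ; exact: derivable_sum_row.
- exact: (@derivable_cst _ _ _ (h0 (lsubmx z))).
rewrite partial_cst addr0 partialZ; last exact: derivable_sum_row.
rewrite partial_sum// (bigD1 k)//= big1 ?addr0 => [|r rk].
  rewrite partialM//.
  by rewrite partial_cst mulr0 add0r partial_coord eqxx mul1r.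
rewrite partialM//.
by rewrite partial_cst mulr0 add0r partial_coord eq_sym (negbTE rk) mul0r.
Qed.

Lemma open_base (U : set 'rV[R]_n) : open U ->
  open [set z : 'rV[R]_(n + n) | U (lsubmx z)].
Proof.
move=> oU; apply: open_comp oU => z _.
exact/differentiable_continuous/differentiable_lsubmx.
Qed.

End SplitCoordinates.

(** * Curvature of the deformed Riemannian extension *)

Lemma invmx_uniq (R : comUnitRingType) n (A B : 'M[R]_n) :
  A *m B = 1%:M -> invmx A = B.
Proof.
by move=> AB; have [uA _] := mulmx1_unit AB; rewrite -(mulKmx uA B) AB mulmx1.
Qed.

(** * The block matrix of the metric and its inverse *)

Section ExtensionMatrix.
Context {R : comUnitRingType} {n : nat}.
Implicit Type S : 'M[R]_n.

Definition ext_mx S : 'M[R]_(n + n) := block_mx S 1%:M 1%:M 0.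

Lemma mul_ext_mx S : ext_mx S *m block_mx 0 1%:M 1%:M (- S) = 1%:M.
Proof.
rewrite mulmx_block !mulmx0 !mulmx1 !mul0mx !mul1mx !add0r !addr0 subrr.
by rewrite -scalar_mx_block.
Qed.

Lemma ext_mx_unit S : ext_mx S \in unitmx.
Proof. by have [] := mulmx1_unit (mul_ext_mx S). Qed.

Lemma invmx_ext S : invmx (ext_mx S) = block_mx 0 1%:M 1%:M (- S).
Proof. exact/invmx_uniq/mul_ext_mx. Qed.

(** The inverse has zero base block and identity off-diagonal blocks, so raising to a base index
    merely reads off the matching fibre component. *)
Lemma invmx_ext_sum_l S k (c : 'I_(n + n) -> R) :
  \sum_l invmx (ext_mx S) (lshift n k) l * c l = c (rshift n k).
Proof.
rewrite invmx_ext big_split_ord/= [X in X + _]big1 => [|l _]; last first.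
  by rewrite block_mxEul mxE mul0r.
rewrite add0r (bigD1 k) //= big1 => [|l lk].
  by rewrite block_mxEur mxE eqxx mul1r addr0.
by rewrite block_mxEur mxE eq_sym (negbTE lk) mul0r.
Qed.

Lemma invmx_ext_sum_r S k (c : 'I_(n + n) -> R) :
  \sum_l invmx (ext_mx S) (rshift n k) l * c l =
  c (lshift n k) - \sum_l S k l * c (rshift n l).
Proof.
rewrite invmx_ext big_split_ord/= -sumrN; congr (_ + _); last first.
  by apply: eq_bigr => l _; rewrite block_mxEdr mxE mulNr.
rewrite (bigD1 k) //= big1 => [|l lk].
  by rewrite block_mxEdl mxE eqxx mul1r addr0.
by rewrite block_mxEdl mxE eq_sym (negbTE lk) mul0r.
Qed.

End ExtensionMatrix.

(** * Christoffel symbols, curvature and Ricci tensor of the extension *)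

Section ExtensionGeometry.
Context {R : realType} {n : nat}.
Variables (U : set 'rV[R]_n) (G : christoffel_symbols R n)
  (Phi : 'rV[R]_n -> 'M[R]_n).
Hypotheses (oU : open U) (sG : forall i j k, smooth U (fun x => G x i j k))
  (sPhi : smooth_mx U Phi)
  (Gsym : forall x, U x -> forall i j k, G x i j k = G x j i k).
Implicit Types (z : 'rV[R]_(n + n)) (i j k l : 'I_n).

Definition ext_block z : 'M[R]_n := \matrix_(i, j)
  (- 2 * \sum_k rsubmx z 0 k * G (lsubmx z) i j k + Phi (lsubmx z) i j).

Definition ext_metric z : 'M[R]_(n + n) := ext_mx (ext_block z).

Definition ext_dblock z k i j : R :=
  - 2 * (\sum_r rsubmx z 0 r * partial k (fun x => G x i j r) (lsubmx z))
  + partial k (fun x => Phi x i j) (lsubmx z).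

(* [i%l] is the base coordinate [x^i], [i%r] the fibre coordinate [y_i]. *)
Local Notation "i '%l'" := (lshift n i) (at level 2, format "i '%l'").
Local Notation "i '%r'" := (rshift n i) (at level 2, format "i '%r'").

Let ext_ll z i j : ext_metric z i%l j%l = ext_block z i j.
Proof. exact: block_mxEul. Qed.
Let ext_lr z i j : ext_metric z i%l j%r = (i == j)%:R.
Proof. by rewrite [LHS]block_mxEur mxE. Qed.
Let ext_rl z i j : ext_metric z i%r j%l = (i == j)%:R.
Proof. by rewrite [LHS]block_mxEdl mxE. Qed.
Let ext_rr z i j : ext_metric z i%r j%r = 0.
Proof. by rewrite [LHS]block_mxEdr mxE. Qed.

Let dG z i j k r : U (lsubmx z) ->
  derivable (fun x => G x i j k) (lsubmx z) (delta_mx 0 r).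
Proof. by move=> Uz; exact: smooth_derivable Uz (sG _ _ _). Qed.

Let dPhi z i j r : U (lsubmx z) ->
  derivable (fun x => Phi x i j) (lsubmx z) (delta_mx 0 r).
Proof. by move=> Uz; exact: smooth_derivable Uz (sPhi _ _). Qed.

Lemma partial_l_ext z k i j : U (lsubmx z) ->
  partial k%l (fun z => ext_metric z i%l j%l) z = ext_dblock z k i j.
Proof.
move=> Uz; rewrite partial_lshift.
under [X in partial _ X]eq_fun do rewrite ext_ll mxE row_mxKl row_mxKr.
have d r : derivable (fun x => rsubmx z 0 r * G x i j r) (lsubmx z)
    (delta_mx 0 k).
  apply: derivableM; last exact: dG.
  exact: (@derivable_cst _ _ _ (rsubmx z 0 r)).
rewrite partialD; [|by apply: derivableZ; exact: derivable_sum_row|exact: dPhi].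
rewrite partialZ; last exact: derivable_sum_row.
rewrite partial_sum// /ext_dblock; congr (_ * _ + _); apply: eq_bigr => r _.
by rewrite partialZ//; exact: dG.
Qed.

Lemma partial_r_ext z k i j :
  partial k%r (fun z => ext_metric z i%l j%l) z = - 2 * G (lsubmx z) i j k.
Proof.
under [X in partial _ X]eq_fun do rewrite ext_ll mxE.
exact: (partial_r_affine (-2) (fun r x => G x i j r) (fun x => Phi x i j)).
Qed.

Lemma partial_ext_lr z (k : 'I_(n + n)) i j :
  partial k (fun z => ext_metric z i%l j%r) z = 0.
Proof.
by under [X in partial _ X]eq_fun do rewrite ext_lr; exact: partial_cst.
Qed.

Lemma partial_ext_rl z (k : 'I_(n + n)) i j :
  partial k (fun z => ext_metric z i%r j%l) z = 0.
Proof.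
by under [X in partial _ X]eq_fun do rewrite ext_rl; exact: partial_cst.
Qed.

Lemma partial_ext_rr z (k : 'I_(n + n)) i j :
  partial k (fun z => ext_metric z i%r j%r) z = 0.
Proof.
by under [X in partial _ X]eq_fun do rewrite ext_rr; exact: partial_cst.
Qed.

Definition ext_partials :=
  (partial_r_ext, partial_ext_lr, partial_ext_rl, partial_ext_rr).

Local Notation LC := (levi_civita ext_metric).

Lemma levi_civita_l z (i j : 'I_(n + n)) k : LC z i j k%l = 2^-1 *
  (partial i (fun z => ext_metric z j k%r) z
   + partial j (fun z => ext_metric z i k%r) z
   - partial k%r (fun z => ext_metric z i j) z).
Proof.
have H := invmx_ext_sum_l (ext_block z) k (fun l : 'I_(n + n) =>
  partial i (fun z => ext_metric z j l) z
  + partial j (fun z => ext_metric z i l) z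
  - partial l (fun z => ext_metric z i j) z).
exact: (congr1 ( *%R 2^-1) H).
Qed.

(** The block [- S] of the inverse meets the same combinations that define the symbols with upper
    base index. Writing the correction through those symbols makes it vanish in most cases. *)
Lemma levi_civita_r z (i j : 'I_(n + n)) k : LC z i j k%r = 2^-1 *
  (partial i (fun z => ext_metric z j k%l) z
   + partial j (fun z => ext_metric z i k%l) z
   - partial k%l (fun z => ext_metric z i j) z)
  - \sum_l ext_block z k l * LC z i j l%l.
Proof.
have H := invmx_ext_sum_r (ext_block z) k (fun l : 'I_(n + n) =>
  partial i (fun z => ext_metric z j l) z
  + partial j (fun z => ext_metric z i l) z
  - partial l (fun z => ext_metric z i j) z).
rewrite [LHS](congr1 ( *%R 2^-1) H) mulrBr; congr (_ - _).
by rewrite mulr_sumr; apply: eq_bigr => l _; rewrite levi_civita_l mulrCA.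
Qed.

(** Only the fibre derivative [- 2 * G] of the block survives, and the factor [-1/2] in front of it
    restores [G]. *)
Lemma LC_lll z i j k : LC z i%l j%l k%l = G (lsubmx z) i j k.
Proof. by rewrite levi_civita_l !ext_partials; field. Qed.

Lemma LC_lrl z i j k : LC z i%l j%r k%l = 0.
Proof. by rewrite levi_civita_l !ext_partials; ring. Qed.

Lemma LC_rll z i j k : LC z i%r j%l k%l = 0.
Proof. by rewrite levi_civita_l !ext_partials; ring. Qed.

Lemma LC_rrl z i j k : LC z i%r j%r k%l = 0.
Proof. by rewrite levi_civita_l !ext_partials; ring. Qed.

Lemma LC_rrr z i j k : LC z i%r j%r k%r = 0.
Proof.
rewrite levi_civita_r !ext_partials big1 => [|l _]; first by ring.
by rewrite LC_rrl mulr0.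
Qed.

Lemma LC_rlr z i j k : LC z i%r j%l k%r = - G (lsubmx z) j k i.
Proof.
rewrite levi_civita_r !ext_partials big1 => [|l _]; first by field.
by rewrite LC_rll mulr0.
Qed.

Lemma LC_lrr z i j k : LC z i%l j%r k%r = - G (lsubmx z) i k j.
Proof.
rewrite levi_civita_r !ext_partials big1 => [|l _]; first by field.
by rewrite LC_lrl mulr0.
Qed.

Lemma LC_llr z i j k : U (lsubmx z) -> LC z i%l j%l k%r =
  2^-1 * (ext_dblock z i j k + ext_dblock z j i k - ext_dblock z k i j)
  - \sum_l ext_block z k l * G (lsubmx z) i j l.
Proof.
move=> Uz; rewrite levi_civita_r !partial_l_ext//.
by under eq_bigr do rewrite LC_lll.
Qed.

Lemma partial_Gsym x i j k l : U x ->
  partial l (fun x => G x i j k) x = partial l (fun x => G x j i k) x.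
Proof. by move=> Ux; apply: partial_ext oU Ux _ => y Uy; exact: Gsym. Qed.

(** A regrouping into the shape of [partial_r_affine], from which the fibre derivative can be read
    off. *)
Lemma LC_llr_affine z i j k : U (lsubmx z) -> LC z i%l j%l k%r =
  - 2 * (\sum_r rsubmx z 0 r *
    (2^-1 * (partial i (fun x => G x j k r) (lsubmx z)
             + partial j (fun x => G x i k r) (lsubmx z)
             - partial k (fun x => G x i j r) (lsubmx z))
     - \sum_m G (lsubmx z) k m r * G (lsubmx z) i j m))
  + (2^-1 * (partial i (fun x => Phi x j k) (lsubmx z)
             + partial j (fun x => Phi x i k) (lsubmx z)
             - partial k (fun x => Phi x i j) (lsubmx z))
     - \sum_m Phi (lsubmx z) k m * G (lsubmx z) i j m).
Proof.
move=> Uz; rewrite LC_llr// /ext_dblock; set x := lsubmx z; set y := rsubmx z.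
have -> : \sum_l ext_block z k l * G x i j l =
    - 2 * (\sum_r y 0 r * \sum_m G x k m r * G x i j m)
    + \sum_m Phi x k m * G x i j m.
  under [X in _ = - 2 * X + _]eq_bigr do rewrite mulr_sumr.
  rewrite exchange_big mulr_sumr -big_split; apply: eq_bigr => m _ /=.
  rewrite mxE mulrDl -mulrA mulr_suml; congr (- 2 * _ + _).
  by apply: eq_bigr => r _; rewrite -/x -/y mulrA.
have -> : \sum_r y 0 r *
    (2^-1 * (partial i (fun x => G x j k r) x + partial j (fun x => G x i k r) x
             - partial k (fun x => G x i j r) x)
     - \sum_m G x k m r * G x i j m) =
    2^-1 * (\sum_r y 0 r * partial i (fun x => G x j k r) x
            + \sum_r y 0 r * partial j (fun x => G x i k r) x
            - \sum_r y 0 r * partial k (fun x => G x i j r) x)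
    - \sum_r y 0 r * \sum_m G x k m r * G x i j m.
  rewrite -big_split -sumrB mulr_sumr -sumrB; apply: eq_bigr => r _ /=; ring.
by field.
Qed.

(** [Phi] enters only the part constant along the fibres and drops out; this is why the Ricci tensor
    of the extension does not see it. *)
Lemma partial_r_LC_llr z i j k l : U (lsubmx z) ->
  partial l%r (fun z => LC z i%l j%l k%r) z =
  - partial i (fun x => G x j k l) (lsubmx z)
  - partial j (fun x => G x i k l) (lsubmx z)
  + partial k (fun x => G x i j l) (lsubmx z)
  + 2 * \sum_m G (lsubmx z) k m l * G (lsubmx z) i j m.
Proof.
move=> Uz.
rewrite (partial_ext _ (open_base oU) (Uz : [set z | U (lsubmx z)] z)
  (fun y (Uy : U (lsubmx y)) => LC_llr_affine i j k Uy)).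
rewrite (partial_r_affine (-2)
  (fun r x => 2^-1 * (partial i (fun x => G x j k r) x
                      + partial j (fun x => G x i k r) x
                      - partial k (fun x => G x i j r) x)
              - \sum_m G x k m r * G x i j m)
  (fun x => 2^-1 * (partial i (fun x => Phi x j k) x
                    + partial j (fun x => Phi x i k) x
                    - partial k (fun x => Phi x i j) x)
            - \sum_m Phi x k m * G x i j m)).
by field.
Qed.

Lemma curvature_anti m (H : christoffel_symbols R m) x (i j k l : 'I_m) :
  curvature H x j i k l = - curvature H x i j k l.
Proof.
rewrite /curvature opprD opprB -sumrN; congr (_ + _).
by apply: eq_bigr => p _; rewrite opprB.
Qed.

Lemma curvature_diag m (H : christoffel_symbols R m) x (i k l : 'I_m) :
  curvature H x i i k l = 0.
Proof.
by apply/eqP; rewrite -[_ == 0](mulrn_eq0 _ 2) mulr2n {1}curvature_anti addNr.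
Qed.

(** Mirrors the pair symmetry of the lowered curvature tensor, which relates this component to the
    purely base one of [curv_llll]; here it is obtained by direct computation. *)
Lemma curv_rllr z i j k l : U (lsubmx z) ->
  curvature LC z i%r j%l k%l l%r = curvature G (lsubmx z) l k j i.
Proof.
move=> Uz; rewrite /curvature partial_r_LC_llr//.
rewrite (partial_l_base (h := fun x => - G x k l i) _ _
  (fun y => LC_rlr y i k l)).
rewrite partialN; last exact: dG.
rewrite big_split_ord/=.
set x := lsubmx z.
(* The derivative of the symbol contributes this quadratic sum twice. One copy cancels here; the
   other, with the fibre half computed next, is the quadratic part of the curvature of [G]. *)
have -> : \sum_(m < n) (LC z j%l k%l m%l * LC z i%r m%l l%r
    - LC z i%r k%l m%l * LC z j%l m%l l%r) = - \sum_m G x k j m * G x l m i.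
  rewrite -sumrN; apply: eq_bigr => m _.
  by rewrite LC_lll LC_rlr LC_rll -/x (Gsym Uz j k) (Gsym Uz m l); ring.
have -> : \sum_(m < n) (LC z j%l k%l m%r * LC z i%r m%r l%r
    - LC z i%r k%l m%r * LC z j%l m%r l%r) = - \sum_m G x l j m * G x k m i.
  rewrite -sumrN; apply: eq_bigr => m _.
  by rewrite LC_rrr LC_rlr LC_lrr -/x (Gsym Uz l j); ring.
rewrite sumrB (partial_Gsym k j i l Uz) (partial_Gsym l j i k Uz).
have -> : \sum_m G x l m i * G x j k m = \sum_m G x k j m * G x l m i.
  by apply: eq_bigr => m _; rewrite mulrC (Gsym Uz j k).
by rewrite -/x; ring.
Qed.

Lemma curv_llll z i j k l :
  curvature LC z i%l j%l k%l l%l = curvature G (lsubmx z) i j k l.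
Proof.
rewrite /curvature.
rewrite !(partial_l_base (h := fun x => G x _ _ l) _ _
  (fun y => LC_lll y _ _ l)) big_split_ord/=; congr (_ + _).
rewrite [X in _ + X]big1 ?addr0 => [|m _]; last by rewrite !LC_lrl; ring.
by apply: eq_bigr => m _; rewrite !LC_lll.
Qed.

Lemma curv_llrl z i j k l : curvature LC z i%l j%l k%r l%l = 0.
Proof.
rewrite /curvature.
rewrite !(partial_eq0 _ _ (fun y => LC_lrl y _ k l)) big_split_ord/= !big1 =>
  [|m _|m _]; rewrite ?LC_lrl; ring.
Qed.

Lemma curv_rlll z i j k l : curvature LC z i%r j%l k%l l%l = 0.
Proof.
rewrite /curvature.
rewrite (partial_r_base (h := fun x => G x j k l) _ _
  (fun y => LC_lll y j k l)).
rewrite (partial_eq0 _ _ (fun y => LC_rll y i k l)) big_split_ord/= !big1 =>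
  [|m _|m _].
- by ring.
- by rewrite LC_rrl LC_lrl; ring.
- by rewrite !LC_rll; ring.
Qed.

Lemma curv_rlr z i j k (l : 'I_(n + n)) : curvature LC z i%r j%l k%r l = 0.
Proof.
rewrite /curvature.
have -> : partial j%l (fun z => LC z i%r k%r l) z = 0.
  by apply: partial_eq0 => y; case: (split_ordP l) => l' ->;
    rewrite ?LC_rrl ?LC_rrr.
have -> : partial i%r (fun z => LC z j%l k%r l) z = 0.
  case: (split_ordP l) => l' -> /=.
    by apply: partial_eq0 => y; rewrite LC_lrl.
  exact: (partial_r_base (h := fun x => - G x j l' k) _ _
    (fun y => LC_lrr y j k l')).
rewrite big1 ?subrr ?addr0// => m _.
case: (split_ordP m) => m' ->; case: (split_ordP l) => l' -> /=;
by rewrite ?LC_lrl ?LC_lrr ?LC_rrl ?LC_rrr; ring.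
Qed.

(** Symbols with a lower fibre index are constant along the fibres, which kills the derivatives;
    each quadratic term contains a vanishing symbol. *)
Lemma curv_rr z i j (k l : 'I_(n + n)) : curvature LC z i%r j%r k l = 0.
Proof.
rewrite /curvature.
have E i' j' : partial j'%r (fun z => LC z i'%r k l) z = 0.
  case: (split_ordP k) => k' ->; case: (split_ordP l) => l' -> /=.
  - by apply: partial_eq0 => y; rewrite LC_rll.
  - exact: (partial_r_base (h := fun x => - G x k' l' i') _ _
    (fun y => LC_rlr y i' k' l')).
  - by apply: partial_eq0 => y; rewrite LC_rrl.
  - by apply: partial_eq0 => y; rewrite LC_rrr.
rewrite !E big1 ?subrr ?addr0// => m _.
case: (split_ordP m) => m' ->; case: (split_ordP l) => l' ->;
case: (split_ordP k) => k' -> /=;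
by rewrite ?(LC_rll, LC_rlr, LC_rrl, LC_rrr); ring.
Qed.

(** The base half of the trace gives the Ricci tensor of [G] by [curv_llll], the fibre half its
    transpose by [curv_rllr]. *)
Lemma ricci_ext z : U (lsubmx z) -> ricci_metric ext_metric z =
  block_mx (ricci G (lsubmx z) + (ricci G (lsubmx z))^T) 0 0 0.
Proof.
move=> Uz; apply/matrixP => j k; rewrite mxE big_split_ord/=.
case: (split_ordP j) => j' ->; case: (split_ordP k) => k' -> /=.
- rewrite block_mxEul !mxE; congr (_ + _); apply: eq_bigr => i _.
    exact: curv_llll.
  by rewrite curv_rllr.
- rewrite block_mxEur mxE !big1 ?addr0// => i _; first exact: curv_rlr.
  exact: curv_llrl.
- rewrite block_mxEdl mxE !big1 ?addr0// => i _; first exact: curv_rr.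
  by rewrite curvature_anti curv_rlll oppr0.
- rewrite block_mxEdr mxE !big1 ?addr0// => i _; first exact: curv_rr.
  by rewrite curvature_anti curv_rlr oppr0.
Qed.

(** The Ricci tensor lives on the base block, exactly where the inverse metric vanishes. *)
Lemma scalar_curvature_ext z :
  U (lsubmx z) -> scalar_curvature ext_metric z = 0.
Proof.
move=> Uz; rewrite /scalar_curvature ricci_ext// /ext_metric invmx_ext.
rewrite big1// => i _; rewrite big1// => j _.
case: (split_ordP i) => i' ->; case: (split_ordP j) => j' -> /=.
- by rewrite block_mxEul mxE mul0r.
- by rewrite [X in _ * X]block_mxEur [X in _ * X]mxE mulr0.
- by rewrite [X in _ * X]block_mxEdl [X in _ * X]mxE mulr0.
- by rewrite [X in _ * X]block_mxEdr [X in _ * X]mxE mulr0.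
Qed.

Lemma riemann_lrll z i j k l : U (lsubmx z) ->
  riemann ext_metric z i%l j%r k%l l%l = - curvature G (lsubmx z) l k i j.
Proof.
move=> Uz; rewrite /riemann big_split_ord/= [X in X + _]big1 => [|m _];
  last first.
  by rewrite curvature_anti curv_rlll oppr0 mul0r.
rewrite add0r (bigD1 l)//= big1 ?addr0 => [|m ml].
  by rewrite ext_rl eqxx mulr1 curvature_anti curv_rllr.
by rewrite ext_rl (negbTE ml) mulr0.
Qed.

Lemma riemann_lrlr z i j k l : riemann ext_metric z i%l j%r k%l l%r = 0.
Proof.
rewrite /riemann big_split_ord/= !big1 ?addr0// => m _.
  by rewrite ext_rr mulr0.
by rewrite curvature_anti curv_rlll oppr0 mul0r.
Qed.

Lemma riemann_lrr z i j k (l : 'I_(n + n)) :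
  riemann ext_metric z i%l j%r k%r l = 0.
Proof.
by rewrite /riemann big1// => m _; rewrite curvature_anti curv_rlr oppr0 mul0r.
Qed.

Lemma riemann_rr z i j (k l : 'I_(n + n)) :
  riemann ext_metric z i%r j%r k l = 0.
Proof. by rewrite /riemann big1// => m _; rewrite curv_rr mul0r. Qed.

Lemma weyl_anti m (g : 'rV[R]_m -> 'M[R]_m) x (i j k l : 'I_m) :
  weyl g x j i k l = - weyl g x i j k l.
Proof.
have E : riemann g x j i k l = - riemann g x i j k l.
  by rewrite /riemann -sumrN; apply: eq_bigr => r _;
    rewrite curvature_anti mulNr.
by rewrite /weyl E; ring.
Qed.

End ExtensionGeometry.

(** * Self-duality *)

(** Multiplication by the block swap [J] makes the matrix unitriangular, and [J] is an involution;
    so the determinant squares to 1. *)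
Lemma norm_det_ext_mx (R : realDomainType) n (S : 'M[R]_n) :
  `|\det (ext_mx S)| = 1.
Proof.
pose J : 'M[R]_(n + n) := block_mx 0 1%:M 1%:M 0.
have J2 : \det J * \det J = 1.
  rewrite -det_mulmx mulmx_block !mulmx0 !mulmx1 ?mul0mx !add0r !addr0.
  by rewrite -scalar_mx_block det1.
have SJ : \det (ext_mx S) * \det J = 1.
  rewrite -det_mulmx mulmx_block !mulmx0 !mulmx1 ?mul0mx !add0r !addr0.
  by rewrite det_ublock !det1 mulr1.
have S2 : \det (ext_mx S) ^+ 2 == 1.
  by rewrite expr2 -[eqbLHS]mulr1 -[X in _ * X == _]J2 mulrACA SJ mulr1.
by move: S2; rewrite sqrf_eq1 => /orP[]/eqP->; rewrite ?normrN normr1.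
Qed.

Section SelfDuality.
Context {R : realType}.

Local Notation "i '%l'" := (@lshift 2 2 i) (at level 2, format "i '%l'").
Local Notation "i '%r'" := (@rshift 2 2 i) (at level 2, format "i '%r'").
Local Notation epsilon := (@epsilon R).

(** Exchanging two indices exchanges two rows of the defining matrix. The three adjacent swaps below
    generate all reorderings used later. *)
Lemma epsilon_tperm (i j k l i' j' k' l' r1 r2 : 'I_4) : r1 != r2 ->
  (forall r, tnth [tuple i'; j'; k'; l'] r =
     tnth [tuple i; j; k; l] (tperm r1 r2 r)) ->
  epsilon i' j' k' l' = - epsilon i j k l.
Proof.
move=> r12 H; rewrite /epsilon -mulN1r -[-1]/((-1) ^+ true) -{}r12 -odd_tperm
  -det_perm -det_mulmx -row_permE.
by congr (\det _); apply/matrixP => r c; rewrite !mxE H.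
Qed.

Lemma epsilon_swap12 (i j k l : 'I_4) : epsilon j i k l = - epsilon i j k l.
Proof.
apply: (@epsilon_tperm _ _ _ _ _ _ _ _ 0 1) => // r; rewrite !(tnth_nth ord0).
by case: r => -[|[|[|[|//]]]] lt_r; rewrite permE.
Qed.

Lemma epsilon_swap23 (i j k l : 'I_4) : epsilon i k j l = - epsilon i j k l.
Proof.
apply: (@epsilon_tperm _ _ _ _ _ _ _ _ 1 2%:R) => // r;
  rewrite !(tnth_nth ord0).
by case: r => -[|[|[|[|//]]]] lt_r; rewrite permE.
Qed.

Lemma epsilon_swap34 (i j k l : 'I_4) : epsilon i j l k = - epsilon i j k l.
Proof.
apply: (@epsilon_tperm _ _ _ _ _ _ _ _ 2%:R 3%:R) => // r;
  rewrite !(tnth_nth ord0).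
by case: r => -[|[|[|[|//]]]] lt_r; rewrite permE.
Qed.

Lemma epsilon_repeat (i j k l : 'I_4) :
  ~~ uniq [:: i; j; k; l] -> epsilon i j k l = 0.
Proof.
move=> nu; have [r1 [r2 [r12 E]]] : exists r1 r2 : 'I_4, r1 != r2 /\
    tnth [tuple i; j; k; l] r1 = tnth [tuple i; j; k; l] r2.
  apply: contrapT => H; move/negP: nu; apply.
  have -> : [:: i; j; k; l] = tval [tuple i; j; k; l] by [].
  apply/tuple_uniqP => r1 r2 E; apply: contrapT => /eqP r12; apply: H.
  by exists r1, r2.
by apply: (determinant_alternate r12) => c; rewrite !mxE E.
Qed.

Lemma epsilon0123 : epsilon 0 1 2%:R 3%:R = 1.
Proof.
rewrite /epsilon -[RHS](det1 R 4); congr (\det _); apply/matrixP => r c;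
  rewrite !mxE.
congr ((_ == _)%:R); rewrite (tnth_nth ord0).
by case: r => -[|[|[|[|//]]]] lt_r; apply/val_inj.
Qed.

Lemma I2_case (P : 'I_2 -> Prop) : P 0 -> P 1 -> forall a, P a.
Proof.
move=> P0 P1 [[|[|//]] lt_a].
  by rewrite (_ : Ordinal lt_a = 0)//; apply/val_inj.
by rewrite (_ : Ordinal lt_a = 1)//; apply/val_inj.
Qed.

Lemma sum_I4 (F : 'I_4 -> R) : \sum_p F p = F 0%l + F 1%l + F 0%r + F 1%r.
Proof.
(* ['I_4] and ['I_(2 + 2)] are convertible, so the sum splits into a base and a fibre half. *)
transitivity (\sum_(p < 2 + 2) F p); first by [].
rewrite big_split_ord/= !big_ord_recl !big_ord0 !addr0 !addrA.
by rewrite (_ : lift ord0 ord0 = 1)//; apply/val_inj.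
Qed.

(** The hypotheses confine [w] to the span of [dx_0 ^ dy_0 + dx_1 ^ dy_1] and [dx_0 ^ dx_1], both
    self-dual for the orientation [(x_0, x_1, y_0, y_1)]. *)
Lemma hodge_star_ext (S : 'M[R]_2) (w : 'I_4 -> 'I_4 -> R) (c : R) :
  S^T = S -> (forall i j, w j i = - w i j) ->
  (forall a b : 'I_2, w a%r b%r = 0) ->
  (forall a b : 'I_2, w a%l b%r = c * (a == b)%:R) ->
  forall i j, hodge_star (ext_mx S) 1 w i j = w i j.
Proof.
move=> ST wA wrr wlr i j.
have wrl (a b : 'I_2) : w a%r b%l = - c * (a == b)%:R.
  by rewrite wA wlr eq_sym mulNr.
have wii p : w p p = 0.
  by apply/eqP; rewrite -[_ == 0](mulrn_eq0 _ 2) mulr2n {1}wA addNr.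
have SC a b : S a b = S b a by rewrite -[in LHS]ST mxE.
have D : `|\det (ext_mx S : 'M[R]_4)| = 1.
  exact (@norm_det_ext_mx _ _ S).
(* [V] is [w] with both indices raised. The volume factor is 1, so the star is half the contraction
   of [V] with [epsilon]. *)
pose V p q := \sum_r invmx (ext_mx S) p r * \sum_t invmx (ext_mx S) q t * w r t.
have -> : hodge_star (ext_mx S) 1 w i j =
    2^-1 * \sum_p \sum_q epsilon i j p q * V p q.
  rewrite /hodge_star; congr (_ * _); apply: eq_bigr => p _;
    apply: eq_bigr => q _.
  rewrite mulr_sumr; apply: eq_bigr => r _; rewrite !mulr_sumr;
    apply: eq_bigr => t _.
  by rewrite /volume_form D sqrtr1 !mul1r !mulrA.
have Vll (a b : 'I_2) : V a%l b%l = 0 by rewrite /V !invmx_ext_sum_l wrr.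
have Vlr (a b : 'I_2) : V a%l b%r = - c * (a == b)%:R.
  rewrite /V invmx_ext_sum_l invmx_ext_sum_r wrl big1 ?subr0// => m _.
  by rewrite wrr mulr0.
have Vrl (a b : 'I_2) : V a%r b%l = c * (a == b)%:R.
  rewrite /V invmx_ext_sum_r invmx_ext_sum_l wlr big1 ?subr0// => m _.
  by rewrite invmx_ext_sum_l wrr mulr0.
(* Raising the two indices produces the corrections [- c * S b a] and [c * S a b], which cancel by
   symmetry of [S]. *)
have Vrr (a b : 'I_2) : V a%r b%r = w a%l b%l.
  have in_l : \sum_t invmx (ext_mx S) b%r t * w a%l t = w a%l b%l - S b a * c.
    rewrite invmx_ext_sum_r (bigD1 a)//= wlr eqxx mulr1 big1 ?addr0// => m ma.
    by rewrite wlr eq_sym (negbTE ma) !mulr0.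
  have in_r m : \sum_t invmx (ext_mx S) b%r t * w m%r t = - c * (m == b)%:R.
    by rewrite invmx_ext_sum_r wrl big1 ?subr0// => p _; rewrite wrr mulr0.
  rewrite /V invmx_ext_sum_r in_l; under eq_bigr do rewrite in_r.
  rewrite (bigD1 b)//= eqxx big1 => [|m mb]; last by rewrite (negbTE mb) !mulr0.
  by rewrite /= (SC b a); ring.
(* Each pair of contracted indices occurs in both orders with equal contributions, which absorbs the
   factor [2^-1]. *)
rewrite !sum_I4 !Vll !Vlr !Vrl !Vrr !wii [w 1%l _]wA !eqxx /=.
rewrite (epsilon_swap34 i j 0%l 0%r) (epsilon_swap34 i j 1%l 1%r).
rewrite (epsilon_swap34 i j 0%r 1%r).
have e1 : epsilon 0%l 1%l 0%r 1%r = 1.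
  by rewrite -epsilon0123; congr (Defs.epsilon _ _ _ _); exact/val_inj.
have e2 : epsilon 1%l 0%l 0%r 1%r = -1 by rewrite epsilon_swap12 e1.
have e3 : epsilon 0%l 0%r 1%l 1%r = -1 by rewrite epsilon_swap23 e1.
have e4 : epsilon 0%r 0%l 1%l 1%r = 1 by rewrite epsilon_swap12 e3 opprK.
have e5 : epsilon 1%l 1%r 0%l 0%r = -1.
  by rewrite epsilon_swap23 epsilon_swap34 e2 opprK.
have e6 : epsilon 1%r 1%l 0%l 0%r = 1 by rewrite epsilon_swap12 e5 opprK.
(* For given [i] and [j] at most one of the three symbols is nonzero; the sixteen cases are checked
   one by one. *)
have -> : w i j = - c * epsilon i j 0%l 0%r - c * epsilon i j 1%l 1%r
    + w 0%l 1%l * epsilon i j 0%r 1%r.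
  case: (@split_ordP 2 2 i) => a ->; case: (@split_ordP 2 2 j) => b ->;
    elim/I2_case: a; elim/I2_case: b; rewrite ?(e1, e2, e3, e4, e5, e6);
    rewrite ?epsilon_repeat// ?wii ?wrr ?wlr ?wrl ?eqxx/= ?[w 1%l 0%l]wA; ring.
by field.
Qed.

End SelfDuality.

(** * The Weyl tensor of the extension of a surface *)

Section WeylExtension.
Context {R : realType}.
Variables (U : set 'rV[R]_2) (G : christoffel_symbols R 2)
  (Phi : 'rV[R]_2 -> 'M[R]_2).
Hypotheses (oU : open U) (sG : forall i j k, smooth U (fun x => G x i j k))
  (sPhi : smooth_mx U Phi)
  (Gsym : forall x, U x -> forall i j k, G x i j k = G x j i k)
  (PhiT : forall x, U x -> (Phi x)^T = Phi x).

Local Notation "i '%l'" := (@lshift 2 2 i) (at level 2, format "i '%l'").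
Local Notation "i '%r'" := (@rshift 2 2 i) (at level 2, format "i '%r'").

Lemma ext_block_sym z :
  U (lsubmx z) -> (ext_block G Phi z)^T = ext_block G Phi z.
Proof.
move=> Uz; apply/matrixP => i j; rewrite !mxE -[in RHS](PhiT Uz) mxE.
by under eq_bigr do rewrite (Gsym Uz).
Qed.

(** The term of the trace at [j] vanishes by antisymmetry, and [1 - j] is the other element of
    ['I_2]. *)
Lemma ricci_surface x (j k : 'I_2) :
  ricci G x j k = curvature G x (1 - j) j k (1 - j).
Proof.
rewrite mxE !big_ord_recl big_ord0 addr0 (_ : lift ord0 ord0 = 1);
  last exact/val_inj.
by elim/I2_case: j; rewrite ?subrr ?subr0 curvature_diag ?add0r ?addr0.
Qed.

Lemma weyl_ext_rr z (a b : 'I_2) k l : U (lsubmx z) ->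
  weyl (ext_metric G Phi) z a%r b%r k l = 0.
Proof.
move=> Uz; rewrite /weyl riemann_rr (scalar_curvature_ext oU sG sPhi Gsym Uz).
rewrite (ricci_ext oU sG sPhi Gsym Uz).
have E i (p : 'I_4) :
    block_mx (ricci G (lsubmx z) + (ricci G (lsubmx z))^T) 0 0 0 i%r p = 0 :> R.
  by case: (@split_ordP 2 2 p) => q ->; rewrite ?block_mxEdl ?block_mxEdr mxE.
by rewrite !E; ring.
Qed.

Lemma weyl_ext_lr z (a b : 'I_2) k l : U (lsubmx z) ->
  weyl (ext_metric G Phi) z a%l b%r k l =
  weyl (ext_metric G Phi) z 0%l 0%r k l * (a == b)%:R.
Proof.
move=> Uz; rewrite /weyl (scalar_curvature_ext oU sG sPhi Gsym Uz).
rewrite (ricci_ext oU sG sPhi Gsym Uz) !mul0r !addr0.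
case: (@split_ordP 2 2 k) => c ->; case: (@split_ordP 2 2 l) => d ->;
  last 3 first.
- rewrite !riemann_lrlr ?block_mxEul ?block_mxEur ?block_mxEdl ?block_mxEdr
  !mxE.
  by ring.
- by rewrite !riemann_lrr ?block_mxEul ?block_mxEur ?block_mxEdl ?block_mxEdr
  !mxE; ring.
- by rewrite !riemann_lrr ?block_mxEul ?block_mxEur ?block_mxEdl ?block_mxEdr
  !mxE; ring.
rewrite !(riemann_lrll oU sG sPhi Gsym)//.
rewrite ?block_mxEul ?block_mxEur ?block_mxEdl ?block_mxEdr.
have -> : (2 + 2)%:R - 2 = 2 :> R by rewrite natrD addrK.
(* In dimension two these four identities express all curvature components that can be nonzero
   through the Ricci tensor. *)
have C01_0 e : curvature G (lsubmx z) 0 1 e 0 = ricci G (lsubmx z) 1 e.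
  by rewrite ricci_surface subrr.
have C10_1 e : curvature G (lsubmx z) 1 0 e 1 = ricci G (lsubmx z) 0 e.
  by rewrite ricci_surface subr0.
have C10_0 e : curvature G (lsubmx z) 1 0 e 0 = - ricci G (lsubmx z) 1 e.
  by rewrite curvature_anti C01_0.
have C01_1 e : curvature G (lsubmx z) 0 1 e 1 = - ricci G (lsubmx z) 0 e.
  by rewrite curvature_anti C10_1.
have Cii e := curvature_diag G (lsubmx z) e.
move: (ricci G (lsubmx z)) C01_0 C10_1 C10_0 C01_1 =>
  rho C01_0 C10_1 C10_0 C01_1.
elim/I2_case: a; elim/I2_case: b; elim/I2_case: c; elim/I2_case: d;
  rewrite ?Cii ?C01_0 ?C10_1 ?C10_0 ?C01_1 !mxE /=; by field.
Qed.

(** With [k] and [l] fixed, the Weyl tensor is a 2-form in its first two slots, of the shape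
    required by [hodge_star_ext]; its component at [0%l], [0%r] is the constant. *)
Lemma weyl_asd_ext z i j k l : U (lsubmx z) ->
  weyl_asd (ext_metric G Phi) 1 z i j k l = 0.
Proof.
move=> Uz; rewrite /weyl_asd.
rewrite (@hodge_star_ext _ _ (fun p q => weyl (ext_metric G Phi) z p q k l)
  (weyl (ext_metric G Phi) z 0%l 0%r k l)).
- by rewrite subrr mulr0.
- exact: ext_block_sym.
- by move=> p q; rewrite weyl_anti.
- by move=> a b; exact: weyl_ext_rr.
- by move=> a b; exact: weyl_ext_lr.
Qed.

End WeylExtension.

(** * The cotangent bundle as a smooth manifold *)

Section SmoothBundle.
Context {R : realType} {n : nat}.
Implicit Types (U : set 'rV[R]_n).

Lemma smooth_base U (f : 'rV[R]_n -> R) : open U -> smooth U f ->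
  smooth [set z : 'rV[R]_(n + n) | U (lsubmx z)] (fun z => f (lsubmx z)).
Proof.
move=> oU sf; apply: (smooth_comp (open_base oU) oU) => // i j.
rewrite (_ : (fun z => _) = (fun z : 'rV[R]_(n + n) => z 0 (lshift n j))).
  exact: smooth_coord.
by apply/funext => z; rewrite mxE ord1.
Qed.

Lemma smooth_fiber (U : set 'rV[R]_(n + n)) j :
  smooth U (fun z => rsubmx z 0 j).
Proof.
rewrite (_ : (fun z => _) = (fun z : 'rV[R]_(n + n) => z 0 (rshift n j))).
  exact: smooth_coord.
by apply/funext => z; rewrite mxE.
Qed.

End SmoothBundle.

(** * Transition functions, Jacobians and the topology of an atlas *)

Section Charts.
Context {R : realType} {n : nat} (M : atlas R n).
Implicit Types (a b c : chart M) (p q : M).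

(** [in_chart] chooses a value over the fibre of the chart map; injectivity leaves only one
    candidate. *)
Lemma in_chartE (V : zmodType) a (h : M -> V) p :
  {in dom a &, injective (crd a)} -> dom a p -> in_chart a h (crd a p) = h p.
Proof.
move=> inj ap; rewrite /in_chart.
have [q [aq qp] hq] := @xgetPex _ 0 (h @` (dom a `&` crd a @^-1` [set crd a p]))
  (ex_intro _ (h p) (ex_intro2 _ _ p (conj ap erefl) erefl)).
by rewrite -[LHS]hq (inj q p)//; exact/mem_set.
Qed.

Hypothesis sM : smooth_atlas M.

Lemma chart_inj a p q : dom a p -> dom a q -> crd a p = crd a q -> p = q.
Proof. by case: sM => _ inj _ _ ap aq; apply: inj; exact/mem_set. Qed.

Lemma transitionE a b p : dom a p -> transition a b (crd a p) = crd b p.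
Proof. by case: sM => _ inj _ _; exact: in_chartE. Qed.

Lemma open_chart_image a : open (chart_image a).
Proof.
case: sM => _ _ /(_ a a) + _; rewrite /overlap /chart_image.
by rewrite setIid.
Qed.

Lemma open_overlap a b : open (overlap a b).
Proof. by case: sM. Qed.

Lemma transition_smooth a b j :
  smooth (overlap a b) (fun x => transition a b x 0 j).
Proof. by case: sM => _ _ _; apply. Qed.

Lemma transition_differentiable a b p j : dom a p -> dom b p ->
  differentiable (fun x => transition a b x 0 j) (crd a p).
Proof.
move=> ap bp; have xo : overlap a b (crd a p) by exists p.
exact: (smooth_differentiable (@open_overlap a b) xo
  (@transition_smooth a b j)).
Qed.

Lemma transition_overlap a b x : overlap a b x ->
  overlap b a (transition a b x).
Proof. by move=> [p [ap bp] <-]; rewrite transitionE//; exists p. Qed.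

Lemma jac_comp a b c p : dom a p -> dom b p -> dom c p ->
  jac a c (crd a p) = jac a b (crd a p) *m jac b c (crd b p).
Proof.
move=> ap bp cp; apply/matrixP => i j; rewrite !mxE.
(* On this open set the transition from [a] to [c] factors through [b], which is what the chain rule
   needs. *)
pose O := overlap a b `&` overlap a c.
have oO : open O by apply: openI; exact: open_overlap.
have Op : O (crd a p) by split; exists p.
rewrite (partial_ext _ oO Op
    (g := (fun y => transition b c y 0 j) \o transition a b)).
  have [_ ->] := chain_rule (phi := transition a b) i
    (fun k => transition_differentiable k ap bp)
    (eq_ind_r (fun y => differentiable _ y) (transition_differentiable j bp cp)
      (transitionE b ap)).
  by apply: eq_bigr => k _; rewrite !mxE transitionE.
move=> y [[q [aq bq] <-] aqc] /=; rewrite !transitionE//.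
Qed.

Lemma jac_id a p : dom a p -> jac a a (crd a p) = 1%:M.
Proof.
move=> ap; apply/matrixP => i j; rewrite !mxE.
rewrite (partial_ext _ (@open_chart_image a) (_ : chart_image a (crd a p))
  (g := fun y => y 0 j)) ?partial_coord//; first by exists p.
by move=> y [q aq <-]; rewrite transitionE.
Qed.

Lemma jac_mulV a b p : dom a p -> dom b p ->
  jac a b (crd a p) *m jac b a (crd b p) = 1%:M.
Proof. by move=> ap bp; rewrite -jac_comp// jac_id. Qed.

Lemma jac_smooth a b i j : smooth (overlap a b) (fun x => jac a b x i j).
Proof.
apply: (smooth_ext (@open_overlap a b) _ (smooth_partial i
  (@transition_smooth a b j))).
by move=> x _; rewrite mxE.
Qed.

Lemma transition_continuous a b x : overlap a b x ->
  {for x, continuous (transition a b)}.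
Proof.
move=> [p [ap bp] <-]; apply: differentiable_continuous;
  apply: differentiable_row => j.
exact: transition_differentiable.
Qed.

Lemma chart_open_dom a : chart_open (dom a).
Proof. by move=> b; rewrite setIC; exact: open_overlap. Qed.

(** Continuity of the chart maps for the topology of [chart_open]: seen in another chart [b], it is
    continuity of the transition function. *)
Lemma chart_open_preimage a (O : set 'rV[R]_n) :
  open O -> chart_open [set p | dom a p /\ O (crd a p)].
Proof.
move=> oO b; rewrite openE => x [p [[ap Op] bp] <-].
have xo : overlap b a (crd b p) by exists p.
have : \forall y \near crd b p, overlap b a y /\ O (transition b a y).
  near=> y; split; near: y.
    exact: open_nbhs_nbhs (conj (@open_overlap b a) xo).
  apply: (transition_continuous xo); apply: open_nbhs_nbhs; split => //.
  by rewrite transitionE.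
apply: filterS => y [[q [bq aq] <-]]; rewrite transitionE// => Oq.
by exists q.
Unshelve. all: by end_near. Qed.

Lemma chart_openI (V W : set M) : chart_open V -> chart_open W ->
  chart_open (V `&` W).
Proof.
move=> oV oW a.
rewrite (_ : _ @` _ = crd a @` (V `&` dom a) `&` crd a @` (W `&` dom a)).
  exact: openI.
apply/seteqP; split => [x [p [[Vp Wp] ap] <-]|x [[p [Vp ap] <-] [q [Wq aq]]]].
  by split; exists p.
by move=> /(chart_inj aq ap) qp; exists p => //; split => //; split => //;
  rewrite -qp.
Qed.

End Charts.

(** * The induced atlas on the cotangent bundle and its topology *)

Section CotangentManifold.
Context {R : realType} {n : nat} (M : atlas R n).
Hypothesis sM : smooth_atlas M.
Implicit Types (a b c : chart M) (p q : M).
Local Notation N := (cotangent_bundle M).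

(** All components of the covector that reads [y] in chart [a], set to zero outside the charts
    around [p] as the record demands. It shows that every fibre value is attained. *)
Definition cov_at a p (y : 'rV[R]_n) b : 'rV[R]_n :=
  if `[< dom b p >] then y *m (jac b a (crd b p))^T else 0.

Lemma cov_at_out a p y b : ~ dom b p -> cov_at a p y b = 0.
Proof. by move=> nbp; rewrite /cov_at; case: asboolP. Qed.

Lemma cov_at_law a p (ap : dom a p) y b c : dom b p -> dom c p ->
  cov_at a p y b = cov_at a p y c *m (jac b c (crd b p))^T.
Proof.
move=> bp cp; rewrite /cov_at (asboolT bp) (asboolT cp).
by rewrite (jac_comp sM bp cp ap) trmx_mul mulmxA.
Qed.

Definition covector_at a p (ap : dom a p) y : covector M :=
  Covector (@cov_at_out a p y) (@cov_at_law a p ap y).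

Lemma crd_covector_at a p (ap : dom a p) y :
  @crd _ _ N a (covector_at ap y) = row_mx (crd a p) y.
Proof. by rewrite /= /cov_at asboolT// (jac_id sM)// trmx1 mulmx1. Qed.

(** The transformation law carries equality from one chart to all charts around the foot, [cov_out]
    settles the others, and proof irrelevance identifies the proof fields. *)
Lemma covector_eq a (v w : covector M) : dom a (foot v) ->
  foot v = foot w -> cov v a = cov w a -> v = w.
Proof.
case: v w => p v vo vl [q w wo wl] /= ap pq; case: _ / pq wo wl => wo wl vw.
have {}vw : v = w.
  apply/funext => b; have [bp|bp] := pselect (dom b p); last by rewrite vo// wo.
  by rewrite (vl b a)// (wl b a)// vw.
by case: _ / vw wo wl => wo wl; congr Covector; exact: Prop_irrelevance.
Qed.

Lemma cotangent_inj a : {in @dom _ _ N a &, injective (@crd _ _ N a)}.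
Proof.
move=> v w /set_mem av /set_mem aw /= /eq_row_mx[vw cvw].
by apply: (covector_eq av) => //; exact: (chart_inj sM av aw).
Qed.

Lemma cotangent_overlapE a b :
  @overlap _ _ N a b = [set z : 'rV[R]_(n + n) | overlap a b (lsubmx z)].
Proof.
apply/seteqP; split=> z.
  by move=> [w [/= aw bw] <-]; rewrite /= row_mxKl; exists (foot w).
move=> /= [p [ap bp] pz]; exists (covector_at ap (rsubmx z)) => //.
by rewrite crd_covector_at pz hsubmxK.
Qed.

Lemma cotangent_chart_imageE a :
  @chart_image _ _ N a = [set z : 'rV[R]_(n + n) | chart_image a (lsubmx z)].
Proof.
have := cotangent_overlapE a a.
by rewrite /overlap /chart_image !setIid.
Qed.

(** The inverse Jacobian is expressed as the Jacobian of the reverse transition at the image point,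
    so its smoothness follows by composition. *)
Definition fiber_transition a b (x y : 'rV[R]_n) : 'rV[R]_n :=
  y *m (jac b a (transition a b x))^T.

Lemma cotangent_transitionE a b z : overlap a b (lsubmx z) ->
  @transition _ _ N a b z =
  row_mx (transition a b (lsubmx z))
    (fiber_transition a b (lsubmx z) (rsubmx z)).
Proof.
move=> [p [ap bp] pz].
have -> : z = @crd _ _ N a (covector_at ap (rsubmx z)).
  by rewrite crd_covector_at pz hsubmxK.
rewrite /transition in_chartE//; last exact: cotangent_inj.
rewrite crd_covector_at row_mxKl row_mxKr /= -/(transition a b)
  /fiber_transition.
by rewrite (transitionE sM)// /cov_at asboolT.
Qed.

Lemma fiber_transition_smooth a b j k :
  smooth (overlap a b) (fun x => jac b a (transition a b x) j k).
Proof.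
apply: (@smooth_comp _ _ _ (transition a b) _ _ (fun y => jac b a y j k)
  (@open_overlap _ _ _ sM a b) (@open_overlap _ _ _ sM b a)
  (@transition_overlap _ _ _ sM a b)) => [i j'|].
  by rewrite ord1; exact: transition_smooth.
exact: jac_smooth.
Qed.

Lemma cotangent_smooth_atlas : smooth_atlas N.
Proof.
have oo (a b : chart M) := @open_overlap _ _ _ sM a b.
split=> [w|a|a b|a b i j]; rewrite ?cotangent_overlapE.
- by have [/(_ (foot w))[a aw] _ _ _] := sM; exists a.
- exact: cotangent_inj.
- exact: open_base.
rewrite ord1.
have E (z : 'rV[R]_(n + n)) : @overlap _ _ M a b (lsubmx z) ->
  row_mx (@transition _ _ M a b (lsubmx z))
    (fiber_transition a b (lsubmx z) (rsubmx z)) 0 j =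
      @transition _ _ N a b z 0 j.
  by move=> /cotangent_transitionE ->.
apply: (smooth_ext (@open_base _ _ _ (oo a b)) E).
case: (split_ordP j) => k ->.
  under [X in smooth _ X]eq_fun do rewrite row_mxEl.
  exact: (smooth_base (oo a b) (@transition_smooth _ _ _ sM a b k)).
under [X in smooth _ X]eq_fun do rewrite row_mxEr mxE.
apply: (smooth_sum (@open_base _ _ _ (oo a b))) => l.
apply: (smoothM (@open_base _ _ _ (oo a b))); first exact: smooth_fiber.
under [X in smooth _ X]eq_fun do rewrite mxE.
exact: (smooth_base (oo a b) (@fiber_transition_smooth a b k l)).
Qed.

Lemma chart_open_foot (V : set M) : chart_open V ->
  @chart_open _ _ N (@foot _ _ M @^-1` V).
Proof.
move=> oV a; rewrite (_ : _ @` _ =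
    [set z : 'rV[R]_(n + n) | (@crd _ _ M a @` (V `&` @dom _ _ M a))
      (lsubmx z)]).
  exact/open_base/oV.
apply/seteqP; split=> z.
  by move=> [w [/= Vw aw] <-]; rewrite /= row_mxKl; exists (foot w).
move=> [p [Vp ap] pz]; exists (covector_at ap (rsubmx z)) => //.
by rewrite crd_covector_at pz hsubmxK.
Qed.

(** Covectors with distinct feet are separated on the base. Those with a common foot share a bundle
    chart, which is injective and takes values in a Hausdorff space. *)
Lemma cotangent_hausdorff : hausdorff_atlas M -> hausdorff_atlas N.
Proof.
move=> hM v w vw; have [fvw|/hM] := pselect (foot v = foot w); last first.
  move=> [V [W [oV oW Vv Ww VW]]]; exists (@foot _ _ M @^-1` V),
    (@foot _ _ M @^-1` W).
  split; [exact: chart_open_foot|exact: chart_open_foot|exact Vv|exact Ww|].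
  by rewrite -preimage_setI VW preimage_set0.
have [/(_ (foot v))[a av] _ _ _] := sM.
have aw : dom a (foot w) by rewrite -fvw.
have cvw : @crd _ _ N a v != @crd _ _ N a w.
  by apply/eqP => /cotangent_inj vw'; apply: vw; apply: vw'; exact/mem_set.
have := @norm_hausdorff R 'rV[R]_(n + n); rewrite open_hausdorff =>
  /(_ _ _ cvw).
move=> [[A B] /= [/set_mem Av /set_mem Bw] [oA oB /eqP AB]].
exists [set u | @dom _ _ N a u /\ A (@crd _ _ N a u)],
  [set u | @dom _ _ N a u /\ B (@crd _ _ N a u)]; split => //.
- exact: (chart_open_preimage cotangent_smooth_atlas).
- exact: (chart_open_preimage cotangent_smooth_atlas).
apply/seteqP; split=> // u [[_ Au] [_ Bu]].
by have : (A `&` B) (@crd _ _ N a u) by []; rewrite AB.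
Qed.

(** The corners form a countable type, so that the boxes can be enumerated through [unpickle]. *)
Definition rational_box (q : n.-tuple (rat * rat)) : set 'rV[R]_n :=
  [set y | forall j, ratr (tnth q j).1 < y 0 j < ratr (tnth q j).2].

Lemma open_rational_box (q : n.-tuple (rat * rat)) : open (rational_box q).
Proof.
suff H (y : 'rV[R]_n) : rational_box q y -> nbhs y (rational_box q).
  by rewrite openE => y; exact: H.
move=> yq.
have H j : nbhs y
    [set u : 'rV[R]_n | ratr (tnth q j).1 < u 0 j < ratr (tnth q j).2].
  rewrite (_ : [set _ | _] = (fun u : 'rV[R]_n => u 0 j) @^-1`
      [set` `]ratr (tnth q j).1, ratr (tnth q j).2[%R]); last first.
    by apply/seteqP; split=> u; rewrite /= in_itv.
  apply: open_nbhs_nbhs; split; last by rewrite /= in_itv; exact: yq.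
  apply: open_comp => [z _|]; first exact: coord_continuous.
  exact: interval_open.
exact: filter_forall H.
Qed.

Lemma rational_box_ball (y : 'rV[R]_n) (e : R) : 0 < e ->
  exists2 q : n.-tuple (rat * rat),
    rational_box q y & rational_box q `<=` ball y e.
Proof.
move=> e0.
have /choice[q1 q1P] (j : 'I_n) :
    exists r : rat, ratr r \in `]y 0 j - e, y 0 j[.
  by apply: rat_in_itvoo; rewrite ltrBlDr ltrDl.
have /choice[q2 q2P] (j : 'I_n) :
    exists r : rat, ratr r \in `]y 0 j, y 0 j + e[.
  by apply: rat_in_itvoo; rewrite ltrDl.
exists [tuple (q1 j, q2 j) | j < n] => [j|u uq].
  by rewrite !tnth_mktuple/=; move: (q1P j) (q2P j); rewrite !in_itv/=
    => /andP[_ ->] /andP[-> _].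
split=> // i j; rewrite ord1 /ball/=; have := uq j; rewrite !tnth_mktuple/=.
move: (q1P j) (q2P j); rewrite !in_itv/=.
move=> /andP[a1 _] /andP[_ a2] /andP[b1 b2].
rewrite ltr_distlC; apply/andP; split; [exact: lt_trans b1|exact: lt_trans a2].
Qed.

(** The atlas may have uncountably many charts, so each basic set inside some chart domain is given
    one such chart by choice. Basic sets and rational boxes in the fibre then yield a countable
    family. *)
Lemma cotangent_second_countable :
  second_countable_atlas M -> second_countable_atlas N.
Proof.
move=> [B [oB Bbase]].
(* [B i] selects a chart, [B i'] shrinks the base inside that chart: the two
   cannot be merged, since a smaller [B i'] may select another chart. *)
pose chart_of i : option (chart M) :=
  if pselect (exists a, B i `<=` dom a) is left H
  then Some (projT1 (cid H)) else None.
pose C (t : nat * nat * n.-tuple (rat * rat)) : set N := [set w |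
  [/\ B t.1.1 (foot w), B t.1.2 (foot w) &
      if chart_of t.1.1 is Some a
      then dom a (foot w) /\ rational_box t.2 (cov w a) else False]].
exists (fun k => if unpickle k is Some t then C t else set0);
  split=> [k|W w oW Ww].
  case: (unpickle k) => [[[i i'] q]|]; last first.
    by move=> a; rewrite set0I image_set0; exact: open0.
  rewrite /C/=; case: (chart_of i) => [a|]; last first.
    by move=> b; rewrite (_ : _ @` _ = set0); [exact: open0|apply/seteqP;
      split=> // z [w [[]]]].
  rewrite (_ : [set _ | _] =
      @foot _ _ M @^-1` B i `&` @foot _ _ M @^-1` B i' `&`
      [set w | @dom _ _ N a w /\ rational_box q (rsubmx (@crd _ _ N a w))]).
    apply: chart_openI; first exact: cotangent_smooth_atlas.
      by apply: chart_openI; [exact: cotangent_smooth_atlas|exact: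
        chart_open_foot..].
    apply: (chart_open_preimage cotangent_smooth_atlas
      (O := [set z : 'rV[R]_(n + n) | rational_box q (rsubmx z)])).
    apply: (@open_comp _ _ (fun z : 'rV[R]_(n + n) => rsubmx z));
      last exact: open_rational_box.
    by move=> z _; exact/differentiable_continuous/differentiable_rsubmx.
  apply/seteqP; split=> v /=; rewrite row_mxKr; first by case=> ? ? [].
  by move=> [[? ?] []].
have [/(_ (foot w))[a0 a0w] _ _ _] := sM.
have [i [iw ia0]] := Bbase _ _ (@chart_open_dom _ _ _ sM a0) a0w.
have [a ia Ea] : exists2 a, B i `<=` dom a & chart_of i = Some a.
  rewrite /chart_of; case: pselect => [H|]; last by case; exists a0.
  by exists (projT1 (cid H)) => //; exact: projT2 (cid H).
have aw : dom a (foot w) := ia _ iw.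
have /nbhs_ballP[e /= e0 eA] : nbhs (@crd _ _ N a w) (@crd _ _ N a @`
  (W `&` @dom _ _ N a)).
  by apply: open_nbhs_nbhs; split; [exact: oW|exists w].
have [q qw qe] := rational_box_ball (cov w a) e0.
(* In the maximum norm, a base ball and a fibre box of the same radius [e] together stay within the
   ball of radius [e] of the bundle chart. *)
have [i' [i'w i'V]] := Bbase _ (foot w)
  (chart_open_preimage sM (a := a) (ball_open (crd a (foot w)) e))
  (conj aw (ballxx _ e0)).
exists (pickle (i, i', q)); rewrite pickleK /C/= Ea;
  split => // v [iv i'v [av qv]].
have [_ [_ fv]] := i'V _ i'v.
have [_ cv] := qe _ qv.
have : ball (@crd _ _ N a w) e (@crd _ _ N a v).
  split=> // k j; case: (split_ordP j) => j' -> /=.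
    by rewrite !row_mxEl.
  by rewrite !row_mxEr.
move=> /eA[u [Wu au] uv].
have [_ /(_ a) inj _ _] := cotangent_smooth_atlas.
by rewrite -(inj u v)//; exact/mem_set.
Qed.

Lemma cotangent_smooth_manifold :
  hausdorff_atlas M -> second_countable_atlas M -> smooth_manifold N.
Proof.
move=> hM cM; split; first exact: cotangent_smooth_atlas.
  exact: cotangent_hausdorff.
exact: cotangent_second_countable.
Qed.

End CotangentManifold.

(** * The extension as a tensor field *)

Section CotangentJacobian.
Context {R : realType} {n : nat} (M : atlas R n).
Hypothesis sM : smooth_atlas M.
Implicit Types (a b : chart M) (x y : 'rV[R]_n) (z : 'rV[R]_(n + n)).
Local Notation N := (cotangent_bundle M).

Definition fiber_jac a b x y : 'M[R]_n :=
  \matrix_(i, j) partial i (fun x => fiber_transition a b x y 0 j) x.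

Lemma fiber_transition_derivable a b x y i j : overlap a b x ->
  derivable (fun x => fiber_transition a b x y 0 j) x (delta_mx 0 i).
Proof.
move=> abx; have oo := @open_overlap _ _ _ sM a b.
suff F : smooth (overlap a b) (fun x => fiber_transition a b x y 0 j).
  exact: (@smooth_derivable _ _ _ _ _ i abx F).
apply: (smooth_ext oo (f := fun x => \sum_k y 0 k * jac b a
  (transition a b x) j k)).
  by move=> u _; rewrite mxE; apply: eq_bigr => k _; rewrite [in RHS]mxE.
apply: (smooth_sum oo) => k; apply: (smoothM oo); first exact: smooth_cst.
exact: fiber_transition_smooth.
Qed.

Lemma fiber_transitionK a b x y : overlap a b x ->
  fiber_transition a b x y *m (jac a b x)^T = y.
Proof.
move=> [p [ap bp] <-]; rewrite /fiber_transition (transitionE sM _ ap).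
by rewrite -mulmxA -trmx_mul (jac_mulV sM ap bp) trmx1 mulmx1.
Qed.

(* [fiber_transitionK], differentiated along the base. *)
Lemma fiber_jacE a b x y : overlap a b x ->
  fiber_jac a b x y *m (jac a b x)^T = - \matrix_(i, l)
    \sum_j fiber_transition a b x y 0 j * partial i (fun x => jac a b x l j) x.
Proof.
move=> abx; apply/matrixP => i l; apply/eqP; rewrite -subr_eq0 !mxE opprK addrC.
have oo := @open_overlap _ _ _ sM a b.
have dJ j : derivable (fun x => jac a b x l j) x (delta_mx 0 i).
  exact: smooth_derivable abx (@jac_smooth _ _ _ sM a b l j).
have : partial i (fun x =>
    \sum_j fiber_transition a b x y 0 j * jac a b x l j) x = 0.
  rewrite (partial_ext _ oo abx (g := fun=> y 0 l)); first exact: partial_cst.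
  move=> u abu; rewrite -[in RHS](fiber_transitionK y abu) [in RHS]mxE.
  by apply: eq_bigr => j _; congr (_ * _); rewrite [RHS]mxE.
have dF j := @fiber_transition_derivable a b x y i j abx.
rewrite partial_sum => [|j]; last by apply: derivableM; [exact: dF|exact: dJ].
move=> E; rewrite -[eqbRHS]E -big_split; apply/eqP; apply: eq_bigr => j _ /=.
by rewrite (partialM (dF j) (dJ j)); congr (_ + _ * _); rewrite mxE.
Qed.

(** Rows are directions of differentiation: the zero block records that the base transition ignores
    the fibre, and the last block that the fibre transition is linear in [y]. *)
Lemma cotangent_jacE a b z : overlap a b (lsubmx z) ->
  @jac _ _ N a b z = block_mx
    (jac a b (lsubmx z)) (fiber_jac a b (lsubmx z) (rsubmx z))
    0 (jac b a (transition a b (lsubmx z)))^T.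
Proof.
move=> abz; have oN := open_base (@open_overlap _ _ _ sM a b).
have Nz : [set z : 'rV[R]_(n + n) | overlap a b (lsubmx z)] z by [].
apply/matrixP => i j; rewrite mxE.
case: (split_ordP j) => j' ->.
  rewrite (partial_ext _ oN Nz (g := fun z => transition a b (lsubmx z) 0 j'));
    last first.
    by move=> u abu; rewrite (cotangent_transitionE sM abu) row_mxEl.
  case: (split_ordP i) => i' ->.
    rewrite block_mxEul mxE.
    exact: (partial_l_base (h := fun x => transition a b x 0 j')).
  rewrite block_mxEdl mxE.
  exact: (partial_r_base (h := fun x => transition a b x 0 j')).
rewrite (partial_ext _ oN Nz
  (g := fun z => fiber_transition a b (lsubmx z) (rsubmx z) 0 j')); last first.
  by move=> u abu; rewrite (cotangent_transitionE sM abu) row_mxEr.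
case: (split_ordP i) => i' ->.
  rewrite block_mxEur mxE partial_lshift.
  by apply: derive_eq_along => h; rewrite row_mxKl row_mxKr.
rewrite block_mxEdr mxE.
have -> : (fun z => fiber_transition a b (lsubmx z) (rsubmx z) 0 j') =
    (fun z => 1 * (\sum_r rsubmx z 0 r *
        jac b a (transition a b (lsubmx z)) j' r) + (fun=> 0) (lsubmx z)).
  apply/funext => u; rewrite mul1r addr0 mxE.
  by apply: eq_bigr => r _; congr (_ * _); rewrite mxE.
rewrite (partial_r_affine 1
  (fun r x => jac b a (transition a b x) j' r) (fun=> 0)).
by rewrite mul1r.
Qed.

(** The diagonal blocks are, up to transposition, mutually inverse Jacobians. *)
Lemma cotangent_det_jac a b z : overlap a b (lsubmx z) ->
  \det (@jac _ _ N a b z) = 1.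
Proof.
move=> abz; rewrite (cotangent_jacE abz) det_ublock det_tr.
case: abz => p [ap bp] <-; rewrite (transitionE sM _ ap) -det_mulmx.
by rewrite (jac_mulV sM ap bp) det1.
Qed.

End CotangentJacobian.

(** * The transformation law of the extended metric *)

Section ExtensionTensor.
Context {R : realType} {n : nat} (M : atlas R n).
Variables (G : connection_data M) (Phi : tensor_data M).
Hypotheses (sM : smooth_atlas M) (cG : is_connection G) (tG : torsion_free G)
  (symPhi : symmetric_tensor_field Phi).
Implicit Types (a b : chart M) (x : 'rV[R]_n) (z : 'rV[R]_(n + n)).
Local Notation N := (cotangent_bundle M).

Lemma riemannian_extensionE a z :
  riemannian_extension G Phi a z = ext_metric (G a) (Phi a) z.
Proof. by []. Qed.

(** This symmetry of second derivatives is extracted from the connection law: by vanishing torsion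
    all its other terms are symmetric in the two lower indices. *)
Lemma jac_partial_sym a b x i l k : overlap a b x ->
  partial i (fun x => jac a b x l k) x = partial l (fun x => jac a b x i k) x.
Proof.
move=> abx; have [_ cl] := cG.
have ax : chart_image a x by case: abx => p [ap _] <-; exists p.
have bx : chart_image b (transition a b x).
  by case: abx => p [ap bp] <-; rewrite (transitionE sM _ ap); exists p.
have := cl _ _ _ abx i l k; have := cl _ _ _ abx l i k.
under eq_bigr do rewrite (tG ax l i).
move=> -> /eqP; rewrite exchange_big.
under [X in _ + X == _]eq_bigr do under eq_bigr do rewrite (tG bx) mulrAC.
by move=> /eqP/addIr.
Qed.

Lemma ext_tensor_law a b z : @overlap _ _ N a b z ->
  ext_metric (G a) (Phi a) z = @jac _ _ N a b z *m
    ext_metric (G b) (Phi b) (@transition _ _ N a b z) *m (@jac _ _ N a b z)^T.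
Proof.
rewrite (cotangent_overlapE sM) => /= abz.
rewrite (cotangent_jacE sM abz) (cotangent_transitionE sM abz) /ext_metric.
set x := lsubmx z in abz *; set y := rsubmx z.
set J := jac a b x; set E := fiber_jac a b x y; set K := jac b a _.
have JK : J *m K = 1%:M.
  by case: abz @J @K => p [ap bp] <- /=; rewrite (transitionE sM _ ap)
    (jac_mulV sM ap bp).
rewrite tr_block_mx trmx0 trmxK /ext_mx !mulmx_block !mulmx0 !mulmx1 !mul0mx
  !addr0 !add0r.
rewrite JK -trmx_mul JK trmx1 ?mul0mx ?addr0; congr block_mx.
set x' := transition a b x; set u := fiber_transition a b x y.
(* [H] is the inhomogeneous term of the connection law, contracted with the new fibre coordinates
   [u]. *)
pose H : 'M[R]_n := \matrix_(i, l)
  \sum_k u 0 k * partial i (fun x => jac a b x l k) x.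
pose C c (v w : 'rV[R]_n) : 'M[R]_n :=
  \matrix_(i, j) \sum_k w 0 k * G c v i j k.
have EJ : E *m J^T = - H by exact: (fiber_jacE sM y abz).
have HT : H^T = H.
  by apply/matrixP => i l; rewrite !mxE; apply: eq_bigr => k _;
    rewrite (jac_partial_sym l i k abz).
have JE : J *m E^T = - H by rewrite -[LHS]trmxK trmx_mul trmxK EJ linearN/= HT.
(* The connection law contracted with the fibre coordinates, by means of [y = u *m J^T]. The
   resulting [-2 H] in the metric is exactly [E *m J^T + J *m E^T]. *)
have CE : C a x y = H + J *m C b x' u *m J^T.
  apply/matrixP => i l; rewrite mxE [in RHS]mxE.
  transitivity (\sum_k u 0 k * \sum_m G a x i l m * J m k).
    under [RHS]eq_bigr do rewrite mulr_sumr.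
    rewrite exchange_big; apply: eq_bigr => m _ /=.
    rewrite -{1}(fiber_transitionK sM y abz) [X in X * _]mxE mulr_suml;
      apply: eq_bigr => k _.
    by rewrite [X in u 0 k * X * _]mxE mulrA mulrAC.
  under eq_bigr do rewrite (cG.2 _ _ _ abz) mulrDr.
  rewrite big_split; congr (_ + _); first by rewrite mxE.
  rewrite [RHS]mxE; under [RHS]eq_bigr do rewrite mxE mulr_suml.
  rewrite [RHS]exchange_big /=; under [LHS]eq_bigr do rewrite mulr_sumr.
  rewrite [LHS]exchange_big; apply: eq_bigr => p _ /=.
  under [LHS]eq_bigr do rewrite mulr_sumr.
  rewrite [LHS]exchange_big; apply: eq_bigr => q _ /=.
  rewrite [X in _ * X * _]mxE [X in _ = _ * X]mxE mulr_sumr mulr_suml.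
  by apply: eq_bigr => k _ /=; rewrite -/x' -/J; ring.
have SE c v w : ext_block (G c) (Phi c) (row_mx v w) = - 2 *: C c v w + Phi c v.
  by apply/matrixP => i l; rewrite !mxE row_mxKl row_mxKr.
rewrite -[z]hsubmxK !SE -/x -/y mulmxDl EJ JE mulmxDr mulmxDl -scalemxAr
  -scalemxAl.
have [_ _ /(_ a b x abz) ->] := symPhi.
rewrite CE -/x' -/J; move: (J *m C b x' u *m J^T)
  (J *m Phi b x' *m J^T) H {EJ HT JE CE}.
by move=> P Q H; apply/matrixP => i l; rewrite !mxE; ring.
Qed.

Lemma ext_pseudo_riemannian : pseudo_riemannian (riemannian_extension G Phi).
Proof.
split; last by move=> a z _; rewrite riemannian_extensionE; exact: ext_mx_unit.
have [sG _] := cG; have [sPhi PhiT _] := symPhi.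
split=> [a|a z|a b z].
- rewrite (cotangent_chart_imageE sM) => i j.
  have oN := open_base (@open_chart_image _ _ _ sM a).
  case: (split_ordP i) => i' ->; case: (split_ordP j) => j' ->.
  + apply: (smooth_ext oN (f := fun z => Phi a (lsubmx z) i' j'
      + - 2 * (\sum_k rsubmx z 0 k * G a (lsubmx z) i' j' k))).
      move=> z _; rewrite riemannian_extensionE /ext_metric block_mxEul mxE.
      exact: addrC.
    apply: (smoothD oN).
      exact: (smooth_base (@open_chart_image _ _ _ sM a) (sPhi a i' j')).
    apply: (smoothM oN); first exact: smooth_cst.
    apply: (smooth_sum oN) => k; apply: (smoothM oN); first exact: smooth_fiber.
    exact: (smooth_base (@open_chart_image _ _ _ sM a) (sG a i' j' k)).
  + apply: (smooth_ext oN (f := fun=> (1%:M : 'M[R]_n) i' j'));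
    last exact: smooth_cst.
    by move=> z _; rewrite riemannian_extensionE /ext_metric block_mxEur.
  + apply: (smooth_ext oN (f := fun=> (1%:M : 'M[R]_n) i' j'));
    last exact: smooth_cst.
    by move=> z _; rewrite riemannian_extensionE /ext_metric block_mxEdl.
  + apply: (smooth_ext oN (f := fun=> (0 : 'M[R]_n) i' j'));
    last exact: smooth_cst.
    by move=> z _; rewrite riemannian_extensionE /ext_metric block_mxEdr.
- rewrite (cotangent_chart_imageE sM) => az.
  rewrite riemannian_extensionE /ext_metric tr_block_mx trmx1 trmx0;
    congr block_mx.
  apply/matrixP => i j; rewrite !mxE -[in RHS](PhiT _ _ az) mxE.
  by under eq_bigr do rewrite (tG az).
- exact: ext_tensor_law.
Qed.

End ExtensionTensor.

(** * Signature, null distribution and quasi-Einstein equation *)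

Section ExtensionStructures.
Context {R : realType} {n : nat} (M : atlas R n).
Variables (G : connection_data M) (Phi : tensor_data M).
Hypotheses (sM : smooth_atlas M) (cG : is_connection G) (tG : torsion_free G)
  (symPhi : symmetric_tensor_field Phi).
Implicit Types (a b : chart M) (x : 'rV[R]_n) (z : 'rV[R]_(n + n)).
Local Notation N := (cotangent_bundle M).

Lemma ext_mx_signature (S : 'M[R]_n) : S^T = S ->
  exists2 P : 'M[R]_(n + n), P \in unitmx &
    P *m ext_mx S *m P^T =
    diag_mx (\row_(i < n + n) (if (i < n)%N then 1 else -1)).
Proof.
(* [B c] makes the pairing of the frames [(1, B c)] and [(1, B d)], which is [S + B c + B d], equal
   to [(c + d) / 2]. The values 1 and -1 give two orthogonal frames of opposite sign. *)
move=> ST; pose B (c : R) : 'M[R]_n := 2^-1 *: (c%:M - S).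
have BT c : (B c)^T = B c.
  by rewrite /B; apply/matrixP => i j; rewrite !mxE eq_sym -[in LHS]ST mxE.
have SBB c d : S + B c + B d = ((c + d) / 2)%:M.
  apply/matrixP => i j; rewrite !mxE; case: (i == j); rewrite ?mulr1n ?mulr0n;
    by field.
pose P : 'M[R]_(n + n) := block_mx 1%:M (B 1) 1%:M (B (-1)).
pose D : 'M[R]_(n + n) := block_mx 1%:M 0 0 (- 1%:M).
have PD : P *m ext_mx S *m P^T = D.
  rewrite /P /ext_mx tr_block_mx !trmx1 !BT.
  rewrite !mulmx_block !mulmx0 !mulmx1 !mul1mx !addr0 !mul1mx !SBB.
  by rewrite subrr addNr mul0r raddf0 -opprD mulNr divff ?pnatr_eq0// raddfN.
(* Since [D] is an involution, [PD] exhibits a right inverse of [P]. *)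
have D2 : D *m D = 1%:M.
  rewrite mulmx_block !mulmx0 !mul0mx !mulmx1 mulmxN mulNmx opprK mulmx1 !addr0
    !add0r.
  by rewrite -scalar_mx_block.
exists P.
  have PP : P *m (ext_mx S *m P^T *m D) = 1%:M by rewrite !mulmxA PD.
  by have [] := mulmx1_unit PP.
rewrite PD; apply/matrixP => i j.
case: (split_ordP i) => i' ->; case: (split_ordP j) => j' ->.
- by rewrite block_mxEul !mxE (inj_eq (@lshift_inj _ _)) /= ltn_ord.
- by rewrite block_mxEur !mxE eq_lrshift.
- by rewrite block_mxEdl !mxE eq_rlshift.
- by rewrite block_mxEdr !mxE (inj_eq (@rshift_inj _ _)) /= ltnNge leq_addr /=
  mulNrn.
Qed.

Definition vertical : 'M[R]_(n + n) := block_mx 0 0 0 1%:M.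

Lemma sub_vertical (v : 'rV[R]_(n + n)) : (v <= vertical)%MS = (lsubmx v == 0).
Proof.
apply/idP/eqP => [/submxP[w ->]|v0].
  rewrite -[w]hsubmxK mul_row_block !mulmx0 mulmx1 addr0 add0r.
  by rewrite row_mxKl.
apply/submxP; exists v; rewrite -[v]hsubmxK v0 mul_row_block.
by rewrite !mulmx0 mulmx1 addr0 add0r.
Qed.

Lemma vertical_distribution :
  @is_distribution _ _ N n (fun _ _ => vertical).
Proof.
split=> [a z _|a b z|a z].
- by rewrite rank_diag_block_mx mxrank0 mxrank1 add0n.
- rewrite (cotangent_overlapE sM) => /= abz; rewrite (cotangent_jacE sM abz).
  set J := @jac _ _ M a b _; set E := fiber_jac _ _ _ _;
    set K := @jac _ _ M b a _.
  (* [K^T] is the vertical block of the Jacobian; its inverse [J^T] provides the reverse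
     inclusion. *)
  have KJ : K^T *m J^T = 1%:M.
    rewrite -trmx_mul; case: abz @J @K {E} => p [ap bp] <- /=.
    by rewrite (transitionE sM _ ap) (jac_mulV sM ap bp) trmx1.
  apply/andP; split; apply/submxP.
    exists (block_mx 0 0 0 K^T).
    by rewrite !mulmx_block !mulmx0 !mul0mx !mulmx1 !mul1mx !addr0 !add0r.
  exists (block_mx 0 0 0 J^T).
  rewrite !mulmx_block !mulmx0 !mul0mx !mul1mx !addr0 !add0r !mulmx0 /vertical.
  by rewrite (mulmx1C KJ).
- rewrite (cotangent_chart_imageE sM) => az.
  exists [set z : 'rV[R]_(n + n) | @chart_image _ _ M a (lsubmx z)],
    (fun=> row_mx 0 1%:M).
  split=> //.
  + exact: (open_base (@open_chart_image _ _ _ sM a)).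
  + by move=> i j; exact: smooth_cst.
  + move=> z' _; apply/andP; split; apply/submxP.
      exists (row_mx 0 1%:M).
      by rewrite mul_row_block !mulmx0 !mulmx1 !add0r.
    exists (col_mx 0 1%:M); rewrite mul_col_row !mul0mx mulmx0 mulmx1 //.
Qed.

Let sGa a i j k : smooth (chart_image a) (fun x => G a x i j k).
Proof. by case: cG. Qed.

Let oc a : open (chart_image a).
Proof. exact: open_chart_image. Qed.

(** The base components of a vertical field vanish, and every symbol with second lower index in the
    fibre and upper index in the base is zero. *)
Lemma vertical_parallel :
  @parallel _ _ N (riemannian_extension G Phi) (fun _ _ => vertical).
Proof.
move=> a U Y oU _ _ YV z i Uz; rewrite sub_vertical; apply/eqP/rowP => k.
have Y0 j u : U u -> Y u 0 (lshift n j) = 0.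
  by move=> /YV; rewrite sub_vertical => /eqP/rowP/(_ j); rewrite !mxE.
rewrite mxE [LHS]mxE [RHS]mxE (partial_ext _ oU Uz (Y0 k)) partial_cst add0r.
rewrite big_split_ord/= !big1 ?addr0 => [|j _|j _];
  [by []| |by rewrite Y0// mulr0].
by case: (split_ordP i) => i' ->; rewrite ?LC_lrl ?LC_rrl mul0r.
Qed.

Lemma vertical_null :
  @totally_null _ _ N (riemannian_extension G Phi) (fun _ _ => vertical).
Proof.
move=> a z _; rewrite riemannian_extensionE /ext_metric /ext_mx.
rewrite !mulmx_block tr_block_mx !mulmx_block.
rewrite !(mulmx0, mul0mx, trmx0, mulmx1, mul1mx, addr0, add0r).
by rewrite /block_mx !row_mx0 col_mx0.
Qed.

(** * Functions pulled back from the base *)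

Section BaseFunction.
Variable h : M -> R.
Hypothesis sh : smooth_function h.
Local Notation F := (fun w : N => h (foot w)).

Lemma in_chart_base a z : chart_image a (lsubmx z) ->
  @in_chart _ _ N _ a F z = in_chart a h (lsubmx z).
Proof.
move=> [p ap pz]; have -> : z = @crd _ _ N a (covector_at sM ap (rsubmx z)).
  by rewrite crd_covector_at pz hsubmxK.
rewrite [LHS]in_chartE//; last exact: cotangent_inj.
rewrite crd_covector_at row_mxKl in_chartE//.
by case: sM.
Qed.

Lemma base_smooth : @smooth_function _ _ N F.
Proof.
move=> a; rewrite (cotangent_chart_imageE sM).
apply: (smooth_ext (open_base (@oc a)) _ (smooth_base (@oc a) (sh a))) => z az.
by rewrite in_chart_base.
Qed.

Lemma base_partial_l a z i : chart_image a (lsubmx z) ->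
  partial (lshift n i) (@in_chart _ _ N _ a F) z =
    partial i (in_chart a h) (lsubmx z).
Proof.
move=> az; rewrite (partial_ext _ (open_base (@oc a)) az (@in_chart_base a)).
exact: partial_l_base.
Qed.

Lemma base_partial_r a z i : chart_image a (lsubmx z) ->
  partial (rshift n i) (@in_chart _ _ N _ a F) z = 0.
Proof.
move=> az; rewrite (partial_ext _ (open_base (@oc a)) az (@in_chart_base a)).
exact: (partial_r_base (h := in_chart a h)).
Qed.

Lemma base_grad a z : chart_image a (lsubmx z) ->
  grad (@in_chart _ _ N _ a F) z = row_mx (grad (in_chart a h) (lsubmx z)) 0.
Proof.
move=> az; apply/rowP => j; rewrite mxE; case: (split_ordP j) => i ->.
  by rewrite row_mxEl mxE base_partial_l.
by rewrite row_mxEr mxE base_partial_r.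
Qed.

(** The differential has only base components, and the base block of the inverse metric is zero. *)
Lemma base_isotropic : @isotropic _ _ N (riemannian_extension G Phi) F.
Proof.
move=> a z; rewrite (cotangent_chart_imageE sM) => az.
rewrite base_grad// riemannian_extensionE /ext_metric invmx_ext mul_row_block.
by rewrite tr_row_mx mul_row_col !mulmx0 !mul0mx !mulmx1 trmx0 !mulmx0 !addr0
  mul0mx.
Qed.

(** Symbols with upper fibre index multiply vanishing fibre derivatives; those with upper base index
    are the symbols of [G] or zero. *)
Lemma base_hessian a z : chart_image a (lsubmx z) ->
  hessian (levi_civita (ext_metric (G a) (Phi a))) (@in_chart _ _ N _ a F) z =
  block_mx (hessian (G a) (in_chart a h) (lsubmx z)) 0 0 0.
Proof.
move=> az; have oN := open_base (@oc a).
apply/matrixP => i j; rewrite mxE big_split_ord/=.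
rewrite [X in _ - (_ + X)]big1 ?addr0 => [|k _];
  last by rewrite base_partial_r// mulr0.
case: (split_ordP j) => j' ->; last first.
  rewrite (partial_ext _ oN az (g := fun=> 0)) => [|u au];
    last by rewrite base_partial_r.
  rewrite partial_cst big1 ?subr0 => [|k _]; last first.
    by case: (split_ordP i) => i' ->; rewrite ?LC_lrl ?LC_rrl mul0r.
  by case: (split_ordP i) => i' ->; rewrite ?block_mxEur ?block_mxEdr mxE.
rewrite (partial_ext _ oN az (fun u au => @base_partial_l a u j' au)).
case: (split_ordP i) => i' ->.
  rewrite block_mxEul mxE (partial_l_base (h := partial j' (in_chart a h)))//.
  by congr (_ - _); apply: eq_bigr => k _; rewrite LC_lll base_partial_l.
rewrite block_mxEdl mxE (partial_r_base (h := partial j' (in_chart a h)))//.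
by rewrite big1 ?subr0// => k _; rewrite LC_rll mul0r.
Qed.

Lemma base_quasi_einstein (mu : R) :
  hausdorff_atlas M -> second_countable_atlas M ->
  (forall a x, chart_image a x ->
    hessian (G a) (in_chart a h) x + 2 *: sym_ricci (G a) x
    - mu *: ((grad (in_chart a h) x)^T *m grad (in_chart a h) x) = 0) ->
  @quasi_einstein _ _ N (riemannian_extension G Phi) F mu 0.
Proof.
move=> hM cM heq; split.
- exact: cotangent_smooth_manifold.
- exact: ext_pseudo_riemannian.
- exact: base_smooth.
move=> a z; rewrite (cotangent_chart_imageE sM) => az; rewrite scale0r.
have [/(_ a) sPhi _ _] := symPhi.
have -> : riemannian_extension G Phi a = ext_metric (G a) (Phi a) by [].
rewrite base_hessian// (ricci_ext (@oc a) (sGa a) sPhi (@tG a) az) base_grad//.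
rewrite tr_row_mx trmx0 mul_col_row !mulmx0 !mul0mx scale_block_mx opp_block_mx.
rewrite !scaler0 !oppr0 !add_block_mx !addr0.
have := heq a _ az; rewrite /sym_ricci scalerA divff ?pnatr_eq0// scale1r => ->.
by rewrite /block_mx !row_mx0 col_mx0.
Qed.

End BaseFunction.

End ExtensionStructures.

(** * The linear form of the affine equation *)

Section ExponentialHessian.
Context {R : realType} {n : nat}.
Variables (U : set 'rV[R]_n) (oU : open U) (h : 'rV[R]_n -> R) (sh :
  smooth U h).
Variable c : R.
Local Notation f := (fun x => expR (c * h x)).

Lemma partial_exp x i : U x ->
  derivable f x (delta_mx 0 i) /\ partial i f x = c * partial i h x * f x.
Proof.
move=> Ux; pose k x := c * h x.
have dh : differentiable h x by exact: smooth_differentiable sh.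
have dk : differentiable k x by exact: differentiableM.
have de : differentiable (@expR R) (k x) by
  apply/derivable1_diffP/derivable_expR.
have df : differentiable (@expR R \o k) x by exact: differentiable_comp.
split; first exact: diff_derivable.
rewrite [LHS](deriveE _ df) diff_comp// diff1E//= -(deriveE _ dk).
rewrite derive1E derive_val /k; congr (_ * _).
rewrite [LHS]partialZ//; exact: diff_derivable.
Qed.

(** For [c = - mu / 2] the bracket is the nonlinear affine expression without its Ricci term. *)
Lemma hessian_exp (G : christoffel_symbols R n) x : U x -> hessian G f x =
  (c * f x) *: (hessian G h x + c *: ((grad h x)^T *m grad h x)).
Proof.
move=> Ux; apply/matrixP => i j; rewrite !mxE big_ord1 !mxE.
have dh y k : U y -> derivable h y (delta_mx 0 k) by move=> Uy;
  exact: smooth_derivable sh.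
rewrite (partial_ext _ oU Ux (g := fun x => (c * partial j h x) * f x));
  last first.
  by move=> y Uy; rewrite (partial_exp j Uy).2.
have d2 : derivable (partial j h) x (delta_mx 0 i).
  exact: smooth_derivable (smooth_partial j sh).
rewrite partialM; [|exact: derivableZ|exact: (partial_exp i Ux).1].
rewrite partialZ// (partial_exp i Ux).2.
under eq_bigr do rewrite (partial_exp _ Ux).2.
have -> : \sum_k G x i j k * (c * partial k h x * f x) =
    c * f x * \sum_k G x i j k * partial k h x.
  by rewrite mulr_sumr; apply: eq_bigr => k _; ring.
by ring.
Qed.

End ExponentialHessian.

(** * Equivalence of the two affine equations, and assembly of the geometric statements *)

Theorem theorem1p1 (R : realType) (M : atlas R 2) (nabla : connection_data M)
    (mu : R) (fhat : M -> R) (Phi : tensor_data M)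
    (Mnabla : affine_surface nabla) (mu_neq0 : mu != 0)
    (fhat_smooth : smooth_function fhat)
    (Phi_sym : symmetric_tensor_field Phi) :
  let f : M -> R := fun p => expR (- (2^-1 * mu) * fhat p) in
  let fhat_eq := forall a x, chart_image a x ->
    hessian (nabla a) (in_chart a fhat) x + 2 *: sym_ricci (nabla a) x
    - (2^-1 * mu) *: ((grad (in_chart a fhat) x)^T *m grad (in_chart a fhat) x) = 0 in
  let f_eq := forall a x, chart_image a x ->
    hessian (nabla a) (in_chart a f) x =
    (mu * in_chart a f x) *: sym_ricci (nabla a) x in
  let N : atlas R 4 := cotangent_bundle M in
  let g : tensor_data N := riemannian_extension nabla Phi in
  let F : N -> R := fun w => fhat (foot w) in
  (fhat_eq <-> f_eq) /\
  (fhat_eq ->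
   [/\ quasi_einstein g F (2^-1 * mu) 0, isotropic g F, walker g &
       self_dual g]).
Proof.
move=> f fhat_eq f_eq N g F.
have [[sM hM cM] cG tG] := Mnabla.
have oc (a : chart M) : open (chart_image a) by exact:
  (@open_chart_image _ _ _ sM a).
split=> [|eq_fhat].
  have fE (a : chart M) x : chart_image a x -> in_chart a f x =
    expR (- (2^-1 * mu) * in_chart a fhat x).
    by move=> [p ap <-]; rewrite !in_chartE//; case: sM.
  (* The defect of the linear equation is [- (mu / 2) * f] times the defect of the nonlinear one.
     This factor never vanishes, so both directions follow. *)
  suff E (a : chart M) x : chart_image a x ->
      hessian (nabla a) (in_chart a f) x - (mu * in_chart a f x) *: sym_ricci
        (nabla a) x =
      (- (2^-1 * mu) * in_chart a f x) *:
      (hessian (nabla a) (in_chart a fhat) x + 2 *: sym_ricci (nabla a) x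
       - (2^-1 * mu) *: ((grad (in_chart a fhat) x)^T *m grad
         (in_chart a fhat) x)).
    split=> H a x ax.
      by apply/eqP; rewrite -subr_eq0 E// H// scaler0.
    have /eqP : (- (2^-1 * mu) * in_chart a f x) *: (hessian (nabla a)
      (in_chart a fhat) x
        + 2 *: sym_ricci (nabla a) x - (2^-1 * mu) *:
        ((grad (in_chart a fhat) x)^T *m grad (in_chart a fhat) x)) = 0.
      by rewrite -E// H// subrr.
    rewrite scaler_eq0 mulf_eq0 oppr_eq0 mulf_eq0 invr_eq0 pnatr_eq0
      (negbTE mu_neq0)/=.
    by rewrite fE// gt_eqF ?expR_gt0//= => /eqP.
  move=> ax.
  (* [in_chart] is meaningful only on the chart image; that set is open, so first and second
     derivatives of the two expressions agree there. *)
  have -> : hessian (nabla a) (in_chart a f) x =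
      hessian (nabla a) (fun x => expR (- (2^-1 * mu) * in_chart a fhat x)) x.
    have pE k y : chart_image a y -> partial k (in_chart a f) y =
        partial k (fun x => expR (- (2^-1 * mu) * in_chart a fhat x)) y.
      by move=> ay; apply: partial_ext (oc a) ay _ => z; exact: fE.
    apply/matrixP => i j; rewrite !mxE (partial_ext _ (oc a) ax (pE j)).
    by congr (_ - _); apply: eq_bigr => k _; rewrite pE.
  rewrite (hessian_exp (oc a) (fhat_smooth a))// -fE//.
  move: (hessian _ _ _) (sym_ricci _ _) (_ *m _) => H r d.
  by apply/matrixP => i j; rewrite !mxE; field.
have sG (a : chart M) : forall i j k, smooth (chart_image a) (fun x =>
  nabla a x i j k).
  by case: cG => + _; apply.
have [sPhi PhiT _] := Phi_sym.
split.
- exact: base_quasi_einstein.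
- exact: base_isotropic.
- split.
    split=> // a z; rewrite (cotangent_chart_imageE sM) => az.
    rewrite /g riemannian_extensionE.
    exact: (ext_mx_signature (ext_block_sym (@tG a) (@PhiT a) az)).
  exists (fun _ _ => @vertical R 2); split.
  + exact: vertical_distribution.
  + exact: vertical_parallel.
  + exact: vertical_null.
- exists (fun _ _ => 1).
    split=> [a x _|a x _|a b z]; [by left|exact: cst_continuous|].
    rewrite (cotangent_overlapE sM) => abz.
    by rewrite (cotangent_det_jac sM abz) sgr1 mul1r.
  move=> a z; rewrite (cotangent_chart_imageE sM) => az i j k l.
  exact: (weyl_asd_ext (oc a) (sG a) (sPhi a) (@tG a) (@PhiT a) i j k l az).
Qed.
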